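(* Let $\lambda$ be a partition with $|\lambda|=N$, let $T\in\mathsf{SYT}(\lambda)$, let $[a,b]\subseteq[1,N]$ be an interval, and let $\mu$ be the shape of $\mathsf{jdt}(T_{[a,b]})$. Then the crystal skeleton $\mathsf{CS}(\mu)$ is a subgraph of $\mathsf{CS}(\lambda)$ up to relabelling of the edges. More precisely, when the edges of crystal skeletons are labeled by Dyck pattern intervals, the edge labels of $\mathsf{CS}(\mu)$ differ from those of the corresponding edges of $\mathsf{CS}(\lambda)$ by a shift of $-a+1$.
   Context: French notation. $T_{[a,b]}$ is the skew tableau obtained by restricting $T$ to the entries in $[a,b]$, and $\mathsf{jdt}$ denotes jeu de taquin rectification to a straight shape. $\mathsf{SYT}(\lambda)$: standard tableaux; $\mathsf{row}(T)$ reads rows left to right from top row to bottom row; $\mathsf{std}$ replaces the $a_j$ entries $j$, in reading order, by $a_1+\dots+a_{j-1}+1,\dots,a_1+\dots+a_j$. Crystal operator $f_i$: in the subword of letters $i,i+1$ of the reading word, bracket each $i+1$ with an unbracketed $i$ to its right (parenthesis matching); $f_i$ changes the rightmost unbracketed $i$ to $i+1$. For a permutation $\pi$ of $[N]$ and $I=[i,i+2m]\subseteq[N]$, $m\ge1$, $I$ is a Dyck pattern interval of $\pi$ if the RSK insertion tableau of the subword $\pi|_I$ of letters in $I$ has bottom row $i,\dots,i+m$ and top row $i+m+1,\dots,i+2m$; a Dyck pattern interval of $T$ is one of $\mathsf{row}(T)$. The crystal skeleton $\mathsf{CS}(\lambda)$ is the directed graph on $\mathsf{SYT}(\lambda)$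 with, for each Dyck pattern interval $I=[i,i+2m]$ of $T$, an edge $T\xrightarrow{I}\mathsf{std}(f_i(b))$, where $b$ is obtained from $T$ by replacing entries $i,\dots,i+m$ by $i$ and $i+m+1,\dots,i+2m$ by $i+1$. (Equivalently, $\mathsf{CS}(\lambda)$ is the crystal $B(\lambda)_n$, $n\ge N$, of semistandard tableaux with entries in $[n]$, with each quasi-crystal $\{b:\mathsf{std}(b)=T\}$ contracted to the vertex $T$.) *)

(* Defs.v *)
(* French notation: a tableau is a seq of rows, row 0 is the
   BOTTOM (longest) row; cells are (row, column), both 0-based. *)
From mathcomp Require Import all_boot.
Set Implicit Arguments. Unset Strict Implicit. Unset Printing Implicit Defensive.

Definition is_part (lam : seq nat) : bool :=
  sorted geq lam && all (fun k => 0 < k) lam.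

Definition tableau := seq (seq nat).

Definition is_SYT (lam : seq nat) (T : tableau) : Prop :=
  [/\ is_part lam, map size T = lam, all (sorted ltn) T,
      (forall r c, c < size (nth [::] T r.+1) ->
         nth 0 (nth [::] T r) c < nth 0 (nth [::] T r.+1) c)
    & perm_eq (flatten T) (iota 1 (sumn lam))].

Definition reading_word (T : tableau) : seq nat := flatten (rev T).

Definition of_word (T : tableau) (w : seq nat) : tableau :=
  rev (reshape (rev (map size T)) w).

Definition std_word (w : seq nat) : seq nat :=
  mkseq (fun p => let x := nth 0 w p in
           (count (fun y => y < x) w + count (pred1 x) (take p w)).+1) (size w).

Definition std (T : tableau) : tableau := of_word T (std_word (reading_word T)).

(* position of the rightmost unbracketed i, where each i+1 is bracketed with
   an unbracketed i to its right (parenthesis matching, i+1 = "(", i = ")") *)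
Fixpoint unbr (i : nat) (w : seq nat) (k pos : nat) (res : option nat)
  : option nat :=
  match w with
  | [::] => res
  | x :: w' =>
      if x == i.+1 then unbr i w' k.+1 pos.+1 res
      else if x == i then
        (if k is k'.+1 then unbr i w' k' pos.+1 res
         else unbr i w' 0 pos.+1 (Some pos))
      else unbr i w' k pos.+1 res
  end.

Definition crystal_f_word (i : nat) (w : seq nat) : option (seq nat) :=
  match unbr i w 0 0 None with
  | Some p => Some (set_nth 0 w p i.+1)
  | None => None
  end.

Definition crystal_f (i : nat) (T : tableau) : option tableau :=
  omap (of_word T) (crystal_f_word i (reading_word T)).

Fixpoint ins_row (x : nat) (r : seq nat) : option nat * seq nat :=
  match r with
  | [::] => (None, [:: x])
  | y :: r' => if x < y then (Some y, x :: r')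
               else let: (o, r'') := ins_row x r' in (o, y :: r'')
  end.

Fixpoint rs_ins (x : nat) (t : tableau) : tableau :=
  match t with
  | [::] => [:: [:: x]]
  | r :: t' => let: (o, r') := ins_row x r in
               match o with None => r' :: t' | Some y => r' :: rs_ins y t' end
  end.

Definition rsk_P (w : seq nat) : tableau := foldl (fun t x => rs_ins x t) [::] w.

Definition is_dyck_interval (N : nat) (w : seq nat) (i m : nat) : bool :=
  [&& 0 < m, 0 < i, i + 2 * m <= N &
   rsk_P [seq x <- w | i <= x <= i + 2 * m] == [:: iota i m.+1; iota (i + m).+1 m]].

Definition dyck_collapse (i m : nat) (T : tableau) : tableau :=
  map (map (fun x => if i <= x <= i + m then i
                     else if i + m < x <= i + 2 * m then i.+1 else x)) T.

Definition CS_edge (lam : seq nat) (T : tableau) (i m : nat) (T' : tableau)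
  : Prop :=
  [/\ is_SYT lam T, is_dyck_interval (sumn lam) (reading_word T) i m &
      exists b', crystal_f i (dyck_collapse i m T) = Some b' /\ T' = std b'].

Definition cell := (nat * nat)%type.
Definition filling := cell -> option nat.

Definition upd (f : filling) (p : cell) (v : option nat) : filling :=
  fun q => if q == p then v else f q.

Inductive slide_out : filling -> cell -> filling -> Prop :=
| slide_stop f r c :
    f (r, c.+1) = None -> f (r.+1, c) = None -> slide_out f (r, c) f
| slide_right f r c x g :
    f (r, c.+1) = Some x ->
    (forall y, f (r.+1, c) = Some y -> x < y) ->
    slide_out (upd (upd f (r, c) (Some x)) (r, c.+1) None) (r, c.+1) g ->
    slide_out f (r, c) g
| slide_up f r c y g :
    f (r.+1, c) = Some y ->
    (forall x, f (r, c.+1) = Some x -> y < x) ->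
    slide_out (upd (upd f (r, c) (Some y)) (r.+1, c) None) (r.+1, c) g ->
    slide_out f (r, c) g.

Definition jdt_step (nu : seq nat) (f : filling) (nu' : seq nat) (f' : filling)
  : Prop :=
  exists r, [/\ 0 < nth 0 nu r, nth 0 nu r.+1 < nth 0 nu r,
                nu' = set_nth 0 nu r (nth 0 nu r).-1 &
                slide_out f (r, (nth 0 nu r).-1) f'].

Inductive rectifies : seq nat -> filling -> filling -> Prop :=
| rect_done nu f : all (fun k => k == 0) nu -> rectifies nu f f
| rect_step nu f nu' f' g :
    jdt_step nu f nu' f' -> rectifies nu' f' g -> rectifies nu f g.

Definition restr_inner (T : tableau) (a : nat) : seq nat :=
  [seq count (fun x => x < a) row | row <- T].

Definition restr (T : tableau) (a b : nat) : filling :=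
  fun p => let row := nth [::] T p.1 in
           if (p.2 < size row) && (a <= nth 0 row p.2 <= b)
           then Some (nth 0 row p.2) else None.

Definition shape_of (g : filling) (mu : seq nat) : Prop :=
  is_part mu /\ forall r c, g (r, c) <> None <-> c < nth 0 mu r.

(* Main.v *)
(* Write w ~ w' for Knuth equivalence and say that w and w' are suffix equivalent
   when the insertion tableaux of all their suffixes of equal length have equal
   shapes.  The crystal operators commute with ~, preserve semistandardness of a
   filling of a fixed skew shape and preserve the suffix equivalence class.  A
   highest weight word is determined by its suffix shapes, because the shape of
   each suffix is its content.  Applying raising operators until both words have
   highest weight therefore shows that: a Knuth class contains one tableau; words
   that are both Knuth and suffix equivalent are equal; being the reading word of a
   semistandard filling of a skew shape only depends on the suffix class.

   Let w0 be the reading word of T restricted to [a,b]; slides preserve its Knuth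
   class, so it is equivalent to a tableau of shape mu.  For S in SYT(mu) there is
   then exactly one word w Knuth equivalent to S (shifted by a - 1) and suffix
   equivalent to w0, and phi S is T with its entries in [a,b] replaced by w.
   Knuth moves only depend on the inversions of a word, and collapsing a Dyck
   pattern interval as well as standardizing preserve inversions; hence the edge
   operator also respects both equivalences, which makes phi a graph map. *)
Require Import Defs.
From Stdlib Require Import ClassicalEpsilon.
From mathcomp Require Import all_boot zify.
Set Implicit Arguments. Unset Strict Implicit. Unset Printing Implicit Defensive.

(** * Crystal operators and Knuth equivalence *)

(** One could define [phi S] by undoing on [S] the slides that rectify the restriction of [T];
    slides would then have to be reversed and shown to commute with the crystal operators.
    Characterizing the word of [phi S] by two equivalences avoids both: an edge is checked by
    locating the resulting word in the two classes. Suffixes rather than prefixes are compared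
    because a letter [i + 1] is bracketed with an [i] to its right: deleting initial letters never
    creates an unbracketed [i + 1], so suffixes of highest weight words have highest weight. Passing
    from a word in [[a,b]] to the whole tableau costs little, because a letter outside an interval
    compares in the same way with all letters inside it, and the two letters on which the operator
    of an edge acts both lie in [[a,b]]. *)

(* [cphi] and [ceps] count the unbracketed letters [i] and [i + 1]; [cf] and [ce]
   leave the word unchanged where the crystal operator is undefined. *)
Fixpoint cphi (i : nat) (w : seq nat) : nat :=
  if w is x :: w' then (x == i) + (cphi i w' - (x == i.+1)) else 0.

Fixpoint ceps (i : nat) (w : seq nat) : nat :=
  if w is x :: w' then ceps i w' + ((x == i.+1) - cphi i w') else 0.

Fixpoint cf (i : nat) (w : seq nat) : seq nat :=
  if w is x :: w' then
    if (x == i.+1) < cphi i w' then x :: cf i w'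
    else (if x == i then i.+1 else x) :: w'
  else [::].

Fixpoint ce (i : nat) (w : seq nat) : seq nat :=
  if w is x :: w' then
    if cphi i w' < (x == i.+1) then i :: w' else x :: ce i w'
  else [::].

(** The tensor product rule: unbracketed letters [i + 1] of the left factor pair off with
    unbracketed [i] of the right factor, and truncated subtraction counts the survivors. *)
Lemma cphi_cat i u v : cphi i (u ++ v) = cphi i u + (cphi i v - ceps i u).
Proof. by elim: u => [|x u IH] /=; rewrite ?subn0 // IH; lia. Qed.

Lemma ceps_cat i u v : ceps i (u ++ v) = ceps i v + (ceps i u - cphi i v).
Proof. by elim: u => [|x u IH] /=; rewrite ?addn0 // cphi_cat IH; lia. Qed.

(** The rightmost unbracketed [i] lies in the right factor exactly when that factor has more
    unbracketed [i] than the left one has unbracketed [i + 1]. *)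
Lemma cf_cat i u v :
  cf i (u ++ v) = if ceps i u < cphi i v then u ++ cf i v else cf i u ++ v.
Proof.
elim: u => [|x u IH] /=.
  case: ltnP => //; elim: v => //= x v IH.
  by case: eqP => [->|_]; case: eqP => //=; case: ltnP => // *; lia.
rewrite cphi_cat IH.
by case: (x =P i.+1) => [->|/eqP nx]; repeat (case: ltnP => ? //=); lia.
Qed.

Lemma ce_cat i u v :
  ce i (u ++ v) = if cphi i v < ceps i u then ce i u ++ v else u ++ ce i v.
Proof.
elim: u => [|x u IH] //=; rewrite cphi_cat IH.
by case: (x =P i.+1) => [->|/eqP nx]; repeat (case: ltnP => ? //=); lia.
Qed.

Lemma size_cf i w : size (cf i w) = size w.
Proof. by elim: w => //= x w IH; case: ifP => _ /=; rewrite ?IH. Qed.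

Lemma cf_phi0 i w : cphi i w = 0 -> cf i w = w.
Proof. by elim: w => //= x w IH; case: ltnP => h1; case: (x =P i) => //=; lia. Qed.

Lemma ce_eps0 i w : ceps i w = 0 -> ce i w = w.
Proof. by elim: w => //= x w IH; case: ltnP => h1 h2; [lia|rewrite IH //; lia]. Qed.

(** [ce] turns the leftmost unbracketed [i + 1] into [i]. Every unbracketed [i] stands to its left,
    so the new letter is the rightmost unbracketed [i], which [cf] changes back. *)
Lemma ceP i w : 0 < ceps i w ->
  [/\ cf i (ce i w) = w, cphi i (ce i w) = (cphi i w).+1
    & ceps i (ce i w) = (ceps i w).-1].
Proof.
elim: w => //= x w IH h.
case: ltnP => h1 /=.
  have -> : cphi i w = 0 by lia.
  have -> : x = i.+1 by case: eqP h1 => //; rewrite ltn0.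
  by rewrite !eqxx /=; split=> //; lia.
have [|a b c] := IH; first lia.
by rewrite /= a b c; split; [case: ltnP => //; lia|lia|lia].
Qed.

(** The sum of the letters is the measure for all inductions that raise words to highest weight. *)
Lemma sumn_ce i w : 0 < ceps i w -> sumn (ce i w) < sumn w.
Proof.
elim: w => //= x w IH h; case: ifP => h1 /=.
  have -> : x = i.+1 by case: eqP h1 => //; rewrite ltn0.
  by lia.
by have := IH; lia.
Qed.

Lemma ceps_mem i w : 0 < ceps i w -> i.+1 \in w.
Proof.
elim: w => //= x w IH h; rewrite inE; case: (0 < ceps i w) / boolP => h1.
  by rewrite IH // orbT.
by move: h; case: eqP => [->|]; rewrite ?eqxx //; lia.
Qed.

(** Each relation occurs in both directions, so that symmetry needs no closure. Equal letters count
    as increasing from left to right, which matches weakly increasing rows. *)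
Inductive knuth_triple : seq nat -> seq nat -> Prop :=
| knuth_triple_xz x y z : x <= y -> y < z -> knuth_triple [:: x; z; y] [:: z; x; y]
| knuth_triple_zx x y z : x <= y -> y < z -> knuth_triple [:: z; x; y] [:: x; z; y]
| knuth_triple_yxz x y z : x < y -> y <= z -> knuth_triple [:: y; x; z] [:: y; z; x]
| knuth_triple_yzx x y z : x < y -> y <= z -> knuth_triple [:: y; z; x] [:: y; x; z].

Inductive knuth : seq nat -> seq nat -> Prop :=
| knuth_refl w : knuth w w
| knuth_step u a a' v w : knuth_triple a a' -> knuth (u ++ a' ++ v) w -> knuth (u ++ a ++ v) w.

Lemma knuth_triple_sym a a' : knuth_triple a a' -> knuth_triple a' a.
Proof. by case=> *; constructor. Qed.

Lemma knuth_trans w1 w2 w3 : knuth w1 w2 -> knuth w2 w3 -> knuth w1 w3.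
Proof. by elim=> // u a a' v w k _ IH /IH; apply: knuth_step. Qed.

Lemma knuth_core u v a a' : knuth_triple a a' -> knuth (u ++ a ++ v) (u ++ a' ++ v).
Proof. by move=> k; apply: knuth_step k _; apply: knuth_refl. Qed.

Lemma knuth_sym w1 w2 : knuth w1 w2 -> knuth w2 w1.
Proof.
elim=> [w|u a a' v w k _ IH]; first exact: knuth_refl.
by apply: knuth_trans IH _; apply/knuth_core/knuth_triple_sym.
Qed.

Lemma knuth_cat2 u v w w' : knuth w w' -> knuth (u ++ w ++ v) (u ++ w' ++ v).
Proof.
elim=> [|s a a' t w1 k _ IH]; first by move=> *; exact: knuth_refl.
have E b : u ++ (s ++ b ++ t) ++ v = (u ++ s) ++ b ++ t ++ v by rewrite !catA.
by rewrite E; apply: knuth_step k _; rewrite -E.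
Qed.

Lemma knuth_catl u w w' : knuth w w' -> knuth (u ++ w) (u ++ w').
Proof. by move=> h; have := knuth_cat2 u [::] h; rewrite !cats0. Qed.

Lemma knuth_catr v w w' : knuth w w' -> knuth (w ++ v) (w' ++ v).
Proof. exact: (@knuth_cat2 [::] v). Qed.

Lemma knuth_triple_perm a a' : knuth_triple a a' -> perm_eq a a'.
Proof.
by case=> x y z _ _; apply/permP=> p /=; lia.
Qed.

Lemma knuth_perm w w' : knuth w w' -> perm_eq w w'.
Proof.
elim=> // u a a' v w1 k _; apply: perm_trans.
by rewrite perm_cat2l perm_cat2r knuth_triple_perm.
Qed.

(** Only the position of the three letters relative to [i] and [i + 1] matters, which leaves
    finitely many cases; in each, the images are equal or differ by one Knuth move. *)
Lemma knuth_triple_crystal i a a' : knuth_triple a a' ->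
  [/\ cphi i a = cphi i a', ceps i a = ceps i a', knuth (cf i a) (cf i a')
    & knuth (ce i a) (ce i a')].
Proof.
have K b b' : knuth_triple b b' -> knuth b b'.
  by move=> k; have := knuth_core [::] [::] k; rewrite !cats0.
have H x y z :
  [/\ x <= y < z -> [/\ cphi i [:: x; z; y] = cphi i [:: z; x; y],
     ceps i [:: x; z; y] = ceps i [:: z; x; y],
     knuth (cf i [:: x; z; y]) (cf i [:: z; x; y])
    & knuth (ce i [:: x; z; y]) (ce i [:: z; x; y])] &
   x < y <= z -> [/\ cphi i [:: y; x; z] = cphi i [:: y; z; x],
     ceps i [:: y; x; z] = ceps i [:: y; z; x],
     knuth (cf i [:: y; x; z]) (cf i [:: y; z; x])
    & knuth (ce i [:: y; x; z]) (ce i [:: y; z; x])]].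
  split=> /andP[h1 h2] /=.
    case: (x =P i) => ex; case: (x =P i.+1) => ex'; try lia;
    case: (y =P i) => ey; case: (y =P i.+1) => ey'; try lia;
    case: (z =P i) => ez; case: (z =P i.+1) => ez'; try lia => /=;
    (split; [done|done| |]); rewrite ?ex ?ex' ?ey ?ey' ?ez ?ez' ;
    solve [exact: knuth_refl | by apply: K; constructor; lia
      | by apply/knuth_sym/K; constructor; lia].
  case: (x =P i) => ex; case: (x =P i.+1) => ex'; try lia;
  case: (y =P i) => ey; case: (y =P i.+1) => ey'; try lia;
  case: (z =P i) => ez; case: (z =P i.+1) => ez'; try lia => /=;
  (split; [done|done| |]); rewrite ?ex ?ex' ?ey ?ey' ?ez ?ez' ;
  solve [exact: knuth_refl | by apply: K; constructor; lia
    | by apply/knuth_sym/K; constructor; lia].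
case=> x y z h1 h2; have [H1 H2] := H x y z.
- by apply: H1; rewrite h1.
- have [|? ? ? ?] := H1; first by rewrite h1.
  by split=> //; apply: knuth_sym.
- by apply: H2; rewrite h1.
- have [|? ? ? ?] := H2; first by rewrite h1.
  by split=> //; apply: knuth_sym.
Qed.

(** By the concatenation rules the choice of the factor to act on depends only on [cphi] and [ceps].
    These agree on both sides of a move, so the operator acts at the same place outside the triple
    or on the triple itself. *)
Lemma knuth_crystal i w w' : knuth w w' ->
  [/\ cphi i w = cphi i w', ceps i w = ceps i w', knuth (cf i w) (cf i w')
    & knuth (ce i w) (ce i w')].
Proof.
elim=> [?|u a a' v w1 k _ [p2 e2 f2 d2]].
  by split=> //; apply: knuth_refl.
have [p1 e1 f1 d1] := knuth_triple_crystal i k.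
rewrite -p2 -e2; split.
- by rewrite !cphi_cat p1 e1.
- by rewrite !ceps_cat !cphi_cat p1 e1.
- apply: knuth_trans f2; rewrite !cf_cat !cphi_cat p1 e1.
  case: ifP => _; last exact: knuth_core.
  apply: knuth_catl; case: ifP => _; last exact: knuth_catr.
  exact: knuth_core [::] _ _ _ k.
- apply: knuth_trans d2; rewrite !ce_cat !cphi_cat p1 e1.
  case: ifP => _; first exact: knuth_core.
  apply: knuth_catl; case: ifP => _; first exact: knuth_catr.
  exact: knuth_core [::] _ _ _ k.
Qed.

(** * Semistandard skew tableaux *)

(** [X] is the row above [Y], and entry [s + j] of [X] lies over entry [j] of [Y]; [zip] restricts
    the comparison to the columns that both rows occupy. *)
Definition rowdom s (X Y : seq nat) :=
  all (fun p => p.2 < p.1) (zip (drop s X) Y).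

(* Rows are listed bottom row first; [head 0 ss] is the number of columns by
   which the bottom row starts to the right of the row above it. *)
Fixpoint sst (ss : seq nat) (t : tableau) : bool :=
  if t is Y :: t' then
    [&& sorted leq Y, rowdom (head 0 ss) (head [::] t') Y,
        size (head [::] t') <= head 0 ss + size Y & sst (behead ss) t']
  else true.

Lemma reading_word_cons Y t : reading_word (Y :: t) = reading_word t ++ Y.
Proof. by rewrite /reading_word rev_cons flatten_rcons. Qed.

Lemma rowdomP s X Y :
  reflect (forall j, j < size Y -> s + j < size X -> nth 0 Y j < nth 0 X (s + j))
          (rowdom s X Y).
Proof.
apply: (iffP (all_nthP (0, 0))); rewrite size_zip size_drop => H j.
  move=> h1 h2; have := H j; rewrite nth_zip_cond size_zip size_drop.
  have -> : j < minn (size X - s) (size Y) by lia.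
  by rewrite /= nth_drop; apply.
move=> h; have := H j; rewrite nth_zip_cond size_zip size_drop h /= nth_drop.
by apply; lia.
Qed.

Lemma sorted_nth_leq Y p q : sorted leq Y -> p <= q -> q < size Y ->
  nth 0 Y p <= nth 0 Y q.
Proof.
move=> sY pq qY; apply: (sorted_leq_nth leq_trans leqnn 0 sY) => //.
by rewrite inE; lia.
Qed.

Lemma sorted_set_nth Y p x : sorted leq Y -> p < size Y ->
  (forall q, q < p -> nth 0 Y q <= x) ->
  (forall q, p < q -> q < size Y -> x <= nth 0 Y q) -> sorted leq (set_nth 0 Y p x).
Proof.
move=> sY pY H1 H2; apply: (path_sorted (x := 0)); apply/(pathP 0) => j.
rewrite size_set_nth (maxn_idPr pY) => jY; case: j jY => [|j] jY //=.
rewrite !nth_set_nth /=; case: eqP => e1; case: eqP => e2; try lia.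
- by apply: H2; lia.
- by apply: H1; lia.
- by apply: sorted_nth_leq => //; lia.
Qed.

Lemma count_path_gt i Y : path leq i.+1 Y -> count_mem i Y = 0.
Proof.
move=> pY; apply/eqP; rewrite -leqn0 leqNgt -has_count.
apply/hasPn => y yY; have := allP (order_path_min leq_trans pY) y yY.
by rewrite /= neq_ltn orbC => ->.
Qed.

Lemma cphi_sorted i Y : sorted leq Y -> cphi i Y = count_mem i Y.
Proof.
elim: Y => //= x Y IH pY; rewrite IH ?(path_sorted pY) //.
case: (x =P i.+1) => [e|] /=; last by rewrite subn0.
by rewrite e in pY; rewrite count_path_gt.
Qed.

Lemma ceps_sorted i Y : sorted leq Y -> ceps i Y = count_mem i.+1 Y.
Proof.
elim: Y => //= x Y IH pY; rewrite IH ?(path_sorted pY) //.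
rewrite cphi_sorted ?(path_sorted pY) //.
case: (x =P i.+1) => [e|] /=; last by rewrite addn0.
by rewrite e in pY; rewrite (count_path_gt pY) addnC.
Qed.

Lemma path_geq_nth x Y q : path leq x Y -> q < size Y -> x <= nth 0 Y q.
Proof.
by move=> pY qY; apply: (allP (order_path_min leq_trans pY)); apply: mem_nth.
Qed.

Lemma cf_sorted i Y : sorted leq Y -> 0 < cphi i Y ->
  exists p, [/\ p < size Y, nth 0 Y p = i,
    forall q, p < q -> q < size Y -> i < nth 0 Y q & cf i Y = set_nth 0 Y p i.+1].
Proof.
elim: Y => //= x Y IH pY h; have sY := path_sorted pY.
case: ltnP => h1.
  have [|p [a b c ->]] := IH sY; first lia.
  by exists p.+1; split=> // -[|q] //=; apply: c.
have xi : x = i by move: h h1; case: eqP => //; lia.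
exists 0; split=> //; last by rewrite xi eqxx.
case=> // q _ qY /=; have := path_geq_nth pY qY.
rewrite xi leq_eqVlt => /orP[/eqP e|//].
have c0 : count_mem i Y = 0 by move: h1; rewrite xi cphi_sorted //; lia.
suff : 0 < count_mem i Y by rewrite c0.
by rewrite -has_count; apply/hasP; exists (nth 0 Y q); rewrite ?mem_nth //= -e.
Qed.

Lemma ce_sorted i Y : sorted leq Y -> 0 < ceps i Y ->
  exists p, [/\ p < size Y, nth 0 Y p = i.+1,
    forall q, q < p -> nth 0 Y q <= i & ce i Y = set_nth 0 Y p i].
Proof.
elim: Y => //= x Y IH pY h; have sY := path_sorted pY.
case: ltnP => h1.
  by exists 0; split=> //=; case: eqP h1 => //; rewrite ltn0.
have [|p [a b c ->]] := IH sY; first lia.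
exists p.+1; split=> // -[|q] /=; last exact: c.
move=> _; have := path_geq_nth pY a; rewrite b leq_eqVlt => /orP[/eqP e|//].
have := ceps_sorted i (Y := x :: Y) pY; have := ceps_sorted i sY => /= e1 e2.
move: h1 h; rewrite e eqxx cphi_sorted // -has_count => /hasP[y yY /eqP ey].
by have := allP (order_path_min leq_trans pY) y yY; rewrite /= ey e; lia.
Qed.

Lemma leq_count_nth (P Q : pred nat) A B :
  (forall q, q < size A -> P (nth 0 A q) -> q < size B /\ Q (nth 0 B q)) ->
  count P A <= count Q B.
Proof.
elim: A B => //= x A IH [|y B] H.
  rewrite /=; suff -> : P x = false.
    by rewrite (leq_trans (IH [::] _)) // => q qA /(H q.+1 qA)[].
  by apply/negP => /(H 0 isT)[].
rewrite leq_add //; last by apply: IH => q qA /(H q.+1 qA).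
by case: (P x) (H 0 isT) => // /(_ isT)[_ /= ->].
Qed.

(** The bottom row is read last and increases weakly, so no [i] follows any of its letters
    [i + 1]. *)
Lemma count_head_ceps i ss t : sst ss t ->
  count_mem i.+1 (head [::] t) <= ceps i (reading_word t).
Proof.
case: t => //= Y t /and4P[sY _ _ _].
by rewrite reading_word_cons ceps_cat ceps_sorted // leq_addr.
Qed.

(** The last conjunct carries the induction: the entries of the bottom row only grow, so a row below
    stays dominated. The danger is a changed [i] with an [i + 1] directly above; bracketing excludes
    it. *)
Lemma cf_sst i ss t : sst ss t ->
  exists t', [/\ reading_word t' = cf i (reading_word t), map size t' = map size t,
    sst ss t' & forall j, nth 0 (head [::] t) j <= nth 0 (head [::] t') j].
Proof.
elim: t ss => [|Y t IH] ss; first by exists [::].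
move=> /= /and4P[sY dY zY st].
have [h0|h0] := posnP (cphi i (reading_word (Y :: t))).
  by exists (Y :: t); rewrite cf_phi0 // /= sY dY zY st.
rewrite reading_word_cons cf_cat; case: ltnP => h1; last first.
  have [t' [E sz st' hd]] := IH _ st.
  have hs : size (head [::] t') = size (head [::] t).
    by move: sz; case: (t') (t) => [|? ?] [|? ?] //= [].
  exists (Y :: t'); rewrite reading_word_cons E /= sz sY st' hs zY /= andbT; split=> //.
  apply/rowdomP => j jY jX; apply: leq_trans (hd _).
  by apply: (rowdomP _ _ _ dY) => //; rewrite -hs.
have [|p [pY pi pg E]] := cf_sorted (i := i) sY; first by lia.
have sz : size (set_nth 0 Y p i.+1) = size Y by rewrite size_set_nth (maxn_idPr pY).
exists (set_nth 0 Y p i.+1 :: t); rewrite reading_word_cons E /= sz zY st /= andbT.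
split=> //; last by move=> j; rewrite nth_set_nth /=; case: eqP => // ->; lia.
apply/andP; split.
  apply: sorted_set_nth => // q qp.
  by apply: (@leq_trans i); rewrite -?pi ?sorted_nth_leq //; lia.
apply/rowdomP => j; rewrite sz nth_set_nth /= => jY jX.
have dj := rowdomP _ _ _ dY j jY jX; case: eqP => // ej.
have {}dj : i < nth 0 (head [::] t) (head 0 ss + j) by rewrite -[i in i < _]pi -ej.
rewrite ltn_neqAle dj andbT.
(* If the entry above were [i + 1], all [i] of [Y], the last of which is the changed one, would have
   [i + 1] above them. Then [t] would have enough unbracketed [i + 1] to bracket every [i] of [Y],
   contrary to [h1]. *)
apply/eqP => ei; move: h1; rewrite ltnNge => /negP; apply.
apply: leq_trans (count_head_ceps i st); rewrite cphi_sorted //.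
rewrite -[X in _ <= count _ X](cat_take_drop (head 0 ss)) count_cat.
apply: leq_trans (leq_addl _ _); apply: leq_count_nth => q qY /= /eqP eq.
have qp : q <= j by rewrite leqNgt; apply/negP => h; have := pg q; lia.
rewrite size_drop nth_drop; split; first by lia.
have := rowdomP _ _ _ dY q qY; rewrite eq => /(_ _) q1.
have sX : sorted leq (head [::] t) by case: (t) st => //= ? ? /and4P[].
have q2 : nth 0 (head [::] t) (head 0 ss + q) <= i.+1.
  by rewrite ei; apply: sorted_nth_leq => //; lia.
by rewrite eqn_leq q2 q1 //; lia.
Qed.

(** Here the danger lies below: a decreased entry may meet an equal one under it. The last conjunct
    is what the row below needs: if the bottom row changed, the word has only as many unbracketed
    [i + 1] as that row has letters [i + 1]. *)
Lemma ce_sst i ss t : sst ss t ->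
  exists t', [/\ reading_word t' = ce i (reading_word t), map size t' = map size t,
    sst ss t' & head [::] t' = head [::] t \/
      head [::] t' = ce i (head [::] t) /\
      ceps i (reading_word t) = count_mem i.+1 (head [::] t)].
Proof.
elim: t ss => [|Y t IH] ss; first by exists [::]; split=> //; left.
move=> /= /and4P[sY dY zY st].
have [h0|h0] := posnP (ceps i (reading_word (Y :: t))).
  by exists (Y :: t); rewrite ce_eps0 // /= sY dY zY st; split=> //; left.
rewrite reading_word_cons ce_cat; case: ltnP => h1; last first.
  have h2 : 0 < ceps i Y by move: h0; rewrite reading_word_cons ceps_cat; lia.
  have [p [pY pi pg E]] := ce_sorted sY h2.
  have sz : size (set_nth 0 Y p i) = size Y by rewrite size_set_nth (maxn_idPr pY).
  exists (ce i Y :: t); rewrite reading_word_cons E /= sz zY st /= andbT; split=> //.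
    apply/andP; split.
      apply: sorted_set_nth => // q qp qY.
      by apply: (@leq_trans i.+1) => //; rewrite -pi sorted_nth_leq //; lia.
    apply/rowdomP => j; rewrite sz nth_set_nth /= => jY jX.
    have := rowdomP _ _ _ dY j jY jX; case: eqP => // ->; rewrite pi; lia.
  right; split=> //; move: h1; rewrite -subn_eq0 ceps_cat => /eqP ->.
  by rewrite addn0 ceps_sorted.
have [t' [E sz st' hd]] := IH _ st.
have hs : size (head [::] t') = size (head [::] t).
  by move: sz; case: (t') (t) => [|? ?] [|? ?] //= [].
exists (Y :: t'); rewrite reading_word_cons E /= sz sY st' hs zY /= andbT.
split=> //; last by left.
case: hd => [->//|[hd1 hd2]].
have sX : sorted leq (head [::] t) by case: (t) st => //= ? ? /and4P[].
have h3 : 0 < ceps i (head [::] t) by rewrite ceps_sorted // -hd2; lia.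
have [p [pX pi pg EX]] := ce_sorted sX h3.
apply/rowdomP => j jY; rewrite hs => jX.
rewrite hd1 EX nth_set_nth /=; have dj := rowdomP _ _ _ dY j jY jX.
case: eqP => // ej; rewrite ej pi in dj.
(* If the entry under the changed one were [i], every [i + 1] of the row above would have an [i]
   under it, and [Y] would bracket all unbracketed [i + 1] of [t], contrary to [h1]. *)
rewrite ltn_neqAle -ltnS dj andbT; apply/eqP => ei.
move: h1; rewrite ltnNge => /negP; apply; rewrite hd2 cphi_sorted //.
rewrite -[X in count _ X <= _](cat_take_drop (head 0 ss)) count_cat.
have -> : count_mem i.+1 (take (head 0 ss) (head [::] t)) = 0.
  apply/eqP; rewrite -leqn0 leqNgt -has_count; apply/hasPn => y.
  case/(nthP 0) => k; rewrite size_take_min => kX <-; rewrite nth_take; last by lia.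
  by apply/eqP => ek; have := pg k; rewrite ek; lia.
apply: leq_count_nth => q; rewrite size_drop nth_drop => qX /eqP eq.
have qY : q < size Y by lia.
split=> //; have qj : j <= q.
  by rewrite leqNgt; apply/negP => h; have := pg (head 0 ss + q); lia.
have q1 := rowdomP _ _ _ dY q qY; rewrite eq in q1.
have q2 : i <= nth 0 Y q by rewrite -ei sorted_nth_leq.
by rewrite /= eqn_leq q2 andbT -ltnS q1 //; lia.
Qed.

(** * Highest weights and insertion *)

(** With [[::]] every shift defaults to 0, so rows are left justified; excluding empty rows makes
    the representation unique. *)
Definition straight (t : tableau) := sst [::] t && all (leq 1) (map size t).

Definition highest_weight (w : seq nat) := forall i, ceps i w = 0.

Lemma hwVe w : highest_weight w \/ exists i, 0 < ceps i w.
Proof.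
case: (boolP (has (fun x => 0 < ceps x.-1 w) w)) => [/hasP[x _ h]|/hasPn h].
  by right; exists x.-1.
left=> i; apply/eqP; rewrite -leqn0 leqNgt; apply/negP => h1.
by have := h _ (ceps_mem h1); rewrite /= h1.
Qed.

Lemma cphi_notin i v : i \notin v -> cphi i v = 0.
Proof. by elim: v => //= x v IH; rewrite inE eq_sym => /norP[/negbTE-> /IH->]. Qed.

(* In reverse reading order the last letter [x] of a row must be preceded by
   [x - 1]; as the rows below only use letters [< k], this forces [x = k]. *)
Lemma hw_sst_above k t v : sst [::] t -> all (leq 1) (map size t) ->
  all (leq k) (head [::] t) -> all (ltn^~ k) v -> highest_weight (reading_word t ++ v) ->
  forall r, nth [::] t r = nseq (size (nth [::] t r)) (k + r).
Proof.
elim: t k v => [|Y t IH] k v; first by move=> _ _ _ _ _ r; rewrite nth_nil.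
move=> /= /and4P[sY dY zY st] /andP[Y0 szt] kY vk hwY r.
have EY : Y = nseq (size Y) k.
  have hwv i : ceps i (Y ++ v) = 0.
    by have := hwY i; rewrite reading_word_cons -catA ceps_cat; lia.
  case/lastP: Y {hwY IH dY zY} sY Y0 kY hwv => // Y x sY _ kY hwv.
  have xk : x <= k.
    rewrite leqNgt; apply/negP => h; have := hwv x.-1.
    rewrite cat_rcons ceps_cat /= cphi_notin; last first.
      by apply/negP => /(allP vk) /=; lia.
    by rewrite prednK ?eqxx; lia.
  apply/all_pred1P/allP => y yY; rewrite /= eqn_leq (allP kY) // andbT.
  apply: leq_trans xk; case/(nthP 0): yY => j jY <-.
  rewrite -[X in _ <= X](last_rcons 0 Y x) -nth_last size_rcons /=.
  by apply: sorted_nth_leq => //; rewrite size_rcons in jY *.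
case: r => [|r] /=; first by rewrite addn0.
rewrite addnS -addSn; apply: (IH _ (Y ++ v)) => //.
- apply/allP => y /(nthP 0)[j jX <-].
  have := rowdomP _ _ _ dY j; rewrite EY nth_nseq size_nseq add0n.
  by rewrite (leq_trans jX zY); apply.
- rewrite all_cat EY; apply/andP; split; first by rewrite all_nseq /= leqnn orbT.
  by apply: sub_all vk => y /=; lia.
- by move=> i; rewrite catA -reading_word_cons.
Qed.

Lemma count_const_rows k t :
  (forall r, nth [::] t r = nseq (size (nth [::] t r)) (k + r)) ->
  forall j, count_mem j (reading_word t) = if j < k then 0 else size (nth [::] t (j - k)).
Proof.
elim: t k => [|Y t IH] k H j; first by rewrite nth_nil; case: ifP.
rewrite reading_word_cons count_cat (IH k.+1); last first.
  by move=> r; have := H r.+1; rewrite addnS addSn.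
have := H 0; rewrite addn0 /= => EY.
have -> : count_mem j Y = if j == k then size Y else 0.
  by rewrite EY count_nseq /= size_nseq eq_sym; case: eqP; rewrite ?mul1n.
case: (ltngtP j k) => h.
- by rewrite ltnW.
- have -> : j < k.+1 = false by lia.
  have -> : j - k = (j - k.+1).+1 by lia.
  by rewrite addn0.
- by rewrite h ltnSn subnn.
Qed.

(** This is the Yamanouchi tableau of the shape. Its rows are filled from 0 on because letters here
    start at 0 and the operators with [i = 0] are included. *)
Lemma hw_straight t : straight t -> highest_weight (reading_word t) ->
  (forall r, nth [::] t r = nseq (size (nth [::] t r)) r) /\
  (forall r, count_mem r (reading_word t) = nth 0 (map size t) r).
Proof.
case/andP=> st sz h.
have H : forall r, nth [::] t r = nseq (size (nth [::] t r)) (0 + r).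
  by apply: (hw_sst_above (v := [::])); rewrite ?cats0 //; apply/allP.
split=> // r; rewrite (count_const_rows H) subn0 /=.
have [rt|rt] := ltnP r (size t); first by rewrite (nth_map [::]).
by rewrite !nth_default ?size_map.
Qed.

Lemma reading_word_inj t t' : reading_word t = reading_word t' ->
  map size t = map size t' -> t = t'.
Proof.
move=> E S; apply: (can_inj revK); apply: eq_from_flatten_shape => //.
by rewrite /shape !map_rev S.
Qed.

Lemma hw_straight_inj t t' : straight t -> straight t' ->
  highest_weight (reading_word t) -> highest_weight (reading_word t') -> map size t = map size t' -> t = t'.
Proof.
move=> s1 s2 h1 h2 E; have [H1 _] := hw_straight s1 h1; have [H2 _] := hw_straight s2 h2.
have sz : size t = size t' by rewrite -(size_map size) E size_map.
apply: (eq_from_nth (x0 := [::]) sz) => r rt.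
by rewrite H1 H2 -!(nth_map _ 0) -?sz // E.
Qed.

Lemma straight_ce i t : straight t -> exists t', [/\ reading_word t' = ce i (reading_word t),
  map size t' = map size t & straight t'].
Proof.
by case/andP => /(ce_sst i)[t' [E S st _]] sz; exists t'; split; rewrite // /straight st S.
Qed.

Lemma leq_size_pos (s s' : seq nat) :
  all (leq 1) s -> (forall r, nth 0 s r = nth 0 s' r) -> size s <= size s'.
Proof.
move=> p E; rewrite leqNgt; apply/negP => h.
by have := all_nthP 0 p _ h; rewrite E nth_default.
Qed.

Lemma knuth_straight_inj t t' : straight t -> straight t' ->
  knuth (reading_word t) (reading_word t') -> t = t'.
Proof.
have [n] := ubnP (sumn (reading_word t)); elim: n t t' => // n IH t t' tn s1 s2 k.
have [h1|[i h1]] := hwVe (reading_word t).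
  have h2 : highest_weight (reading_word t') by move=> i; have [_ <-] := knuth_crystal i k.
  apply: hw_straight_inj => //.
  have E r : nth 0 (map size t) r = nth 0 (map size t') r.
    rewrite -(hw_straight s1 h1).2 -(hw_straight s2 h2).2.
    by have /permP := knuth_perm k; apply.
  have [/andP[_ p1] /andP[_ p2]] := (s1, s2).
  apply: (eq_from_nth (x0 := 0)) => [|r _]; last exact: E.
  by apply/eqP; rewrite eqn_leq !leq_size_pos.
have [_ e2 _ k2] := knuth_crystal i k.
have [u [E S su]] := straight_ce i s1; have [u' [E' S' su']] := straight_ce i s2.
have uu : u = u'.
  apply: IH => //; last by rewrite E E'.
  by rewrite E; have := sumn_ce h1; lia.
apply: reading_word_inj; last by rewrite -S -S' uu.
have [<- _ _] := ceP h1; have [|<- _ _] := @ceP i (reading_word t').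
  by rewrite -e2.
by rewrite -E -E' uu.
Qed.

(** Row insertion as a chain of Knuth moves: [x] travels left over [r2] up to [y], then [y] travels
    left over [r1]. *)
Lemma knuth_bump r1 y r2 x : sorted leq (r1 ++ y :: r2) -> all (leq^~ x) r1 -> x < y ->
  knuth (r1 ++ y :: r2 ++ [:: x]) (y :: r1 ++ x :: r2).
Proof.
move=> sr r1x xy.
have H1 : knuth (y :: r2 ++ [:: x]) (y :: x :: r2).
  have {sr r1x}: sorted leq (y :: r2) by apply: (subseq_sorted leq_trans) sr; apply: suffix_subseq.
  elim: r2 y xy => [|z r2 IH] y xy /=; first by move=> _; apply: knuth_refl.
  case/andP=> yz pz; have := knuth_catl [:: y] (IH z (leq_trans xy yz) pz).
  move/knuth_trans; apply; exact: (knuth_core [::] r2 (knuth_triple_yzx xy yz)).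
apply: knuth_trans (knuth_catl r1 H1) _.
elim: r1 {H1} sr r1x => [|a r1 IH] /= sr; first by move=> _; apply: knuth_refl.
case/andP=> ax r1x; apply: knuth_trans (knuth_catl [:: a] (IH (path_sorted sr) r1x)) _.
case: r1 {IH} sr r1x => [|b r1] /= sr r1x.
  exact: (knuth_core [::] r2 (knuth_triple_xz ax xy)).
case/andP: r1x => bx _; case/andP: sr => ab _.
exact: (knuth_core [::] (r1 ++ x :: r2) (knuth_triple_xz ab (leq_ltn_trans bx xy))).
Qed.

(** If no entry exceeds [x], then [find] returns the size of [r] and [set_nth] appends [x]. *)
Lemma ins_rowE x r : ins_row x r =
  (if find (ltn x) r < size r then Some (nth 0 r (find (ltn x) r)) else None,
   set_nth 0 r (find (ltn x) r) x).
Proof. by elim: r => //= y r IH; case: ifP => //= _; rewrite IH ltnS. Qed.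

Lemma knuth_rs_ins x t : sst [::] t -> knuth (reading_word t ++ [:: x]) (reading_word (rs_ins x t)).
Proof.
elim: t x => [|Y t IH] x /=; first by move=> _; apply: knuth_refl.
case/and4P=> sY _ _ st; rewrite ins_rowE; set q := find _ _.
case: ifP => qY; rewrite !reading_word_cons; last first.
  have -> : set_nth 0 Y q x = Y ++ [:: x].
    have -> : q = size Y by apply/eqP; rewrite eqn_leq find_size leqNgt qY.
    by rewrite cats1; elim: (Y) => //= a s ->.
  by rewrite catA; apply: knuth_refl.
have EY : Y = take q Y ++ nth 0 Y q :: drop q.+1 Y by rewrite -drop_nth // cat_take_drop.
have -> : set_nth 0 Y q x = take q Y ++ x :: drop q.+1 Y.
  by elim: (Y) (q) qY => [|a s IHs] [|p] //= ps; rewrite ?drop0 // IHs.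
apply: knuth_trans (knuth_catr _ (IH (nth 0 Y q) st)).
rewrite -!catA; apply: knuth_catl; rewrite {1}EY -catA /=.
apply: knuth_bump; rewrite -?EY //.
  apply/allP => y /(nthP 0)[j]; rewrite size_take qY => jq <-.
  by rewrite nth_take //; have := before_find 0 jq; rewrite /=; lia.
by apply: (nth_find 0); rewrite has_find.
Qed.

Lemma rs_ins_sst x t : sst [::] t -> sst [::] (rs_ins x t) /\
  head [::] (rs_ins x t) = set_nth 0 (head [::] t) (find (ltn x) (head [::] t)) x.
Proof.
elim: t x => [|Y t IH] x //= /and4P[sY dY zY st]; rewrite ins_rowE.
set q := find _ _.
have qsz : q <= size Y by apply: find_size.
have lq j : j < q -> nth 0 Y j <= x by move=> /(before_find 0); rewrite /=; lia.
case: ifP => qY /=; split=> //.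
  have xq : x < nth 0 Y q by apply: (nth_find 0); rewrite has_find.
  have [-> hd] := IH (nth 0 Y q) st; rewrite andbT.
  have szY : size (set_nth 0 Y q x) = size Y by rewrite size_set_nth; lia.
  set X := head [::] t in dY zY hd *; set p := find _ _ in hd.
  have pX : p <= size X by apply: find_size.
  (* The entry of [X] above column [q], if there is one, exceeds the bumped letter, so that letter
     lands weakly left of [q]. *)
  have pq : p <= q.
    rewrite leqNgt; apply/negP => h; have := before_find 0 h => /=.
    by have := rowdomP _ _ _ dY q qY; rewrite add0n; lia.
  rewrite hd szY add0n size_set_nth; apply/and3P; split; [| |by lia].
    apply: sorted_set_nth => // j qj jY.
    by apply: leq_trans (ltnW xq) _; apply: sorted_nth_leq => //; lia.
  apply/rowdomP => j; rewrite szY size_set_nth add0n !nth_set_nth /= => jY jX.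
  case: eqP => ej; case: eqP => ep //.
  - rewrite ej in ep jX *.
    by have := rowdomP _ _ _ dY q qY; rewrite add0n; lia.
  - by apply: leq_ltn_trans xq; apply: lq; lia.
  - by apply: (rowdomP _ _ _ dY); lia.
have eq : q = size Y by lia.
have szY : size (set_nth 0 Y q x) = (size Y).+1 by rewrite size_set_nth; lia.
rewrite szY st andbT; apply/and3P; split; [| |by lia].
  apply: (path_sorted (x := 0)); apply/(pathP 0) => j.
  rewrite szY => jY; case: j jY => [|j] jY //=; rewrite !nth_set_nth /=.
  case: eqP => e1; case: eqP => e2 //; try lia.
  - by apply: lq; lia.
  - by apply: sorted_nth_leq => //; lia.
apply/rowdomP => j _; rewrite nth_set_nth /= => jX.
by case: eqP => ej; [lia|apply: (rowdomP _ _ _ dY); lia].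
Qed.

Lemma rs_ins_pos x t : all (leq 1) (map size t) -> all (leq 1) (map size (rs_ins x t)).
Proof.
elim: t x => [|Y t IH] x //= /andP[Y0 st]; rewrite ins_rowE.
by case: ifP => _ /=; rewrite size_set_nth; apply/andP; split; rewrite ?IH //; lia.
Qed.

Lemma rsk_PP w : knuth w (reading_word (rsk_P w)) /\ straight (rsk_P w).
Proof.
elim/last_ind: w => [|w x [k /andP[st sz]]]; first by split=> //; apply: knuth_refl.
rewrite /rsk_P foldl_rcons -/(rsk_P w) /straight; split.
  by rewrite -cats1; apply: knuth_trans (knuth_catr _ k) (knuth_rs_ins _ st).
by rewrite rs_ins_pos // andbT; have [] := rs_ins_sst x st.
Qed.

Lemma rsk_P_knuth w w' : knuth w w' -> rsk_P w = rsk_P w'.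
Proof.
move=> k; have [k1 s1] := rsk_PP w; have [k2 s2] := rsk_PP w'.
apply: knuth_straight_inj => //; apply: knuth_trans (knuth_sym k1) _.
exact: knuth_trans k k2.
Qed.

Lemma rsk_P_reading t : straight t -> rsk_P (reading_word t) = t.
Proof. by move=> st; have [k s] := rsk_PP (reading_word t); apply/esym/knuth_straight_inj. Qed.

(** * Words with the same inversions *)

(** A list of pairs carries two words in parallel; [pairwise agree] says that their inversions are
    at the same positions. A word and its standardization are related in this way, and so are a word
    and its collapse along a Dyck pattern interval. *)
Definition agree (a b : nat * nat) := (b.1 < a.1) == (b.2 < a.2).

Lemma map_eq_cat (A B : Type) (f : A -> B) s u v : map f s = u ++ v ->
  exists s1 s2, [/\ s = s1 ++ s2, map f s1 = u & map f s2 = v].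
Proof.
move=> E; exists (take (size u) s), (drop (size u) s); split.
- by rewrite cat_take_drop.
- by rewrite map_take E take_size_cat.
- by rewrite map_drop E drop_size_cat.
Qed.

(** Whether a Knuth move applies to three letters depends only on their inversions. The pairs
    themselves are only permuted, which preserves their comparison with the letters around the
    triple. *)
Lemma knuth_triple_agree a a' zs : knuth_triple a a' -> pairwise agree zs -> unzip1 zs = a ->
  exists zs', [/\ unzip1 zs' = a', pairwise agree zs', perm_eq zs zs'
    & knuth_triple (unzip2 zs) (unzip2 zs')].
Proof.
move=> k; case: zs => [|[x1 x2] [|[y1 y2] [|[z1 z2] [|? ?]]]] pz; try by case: k.
rewrite /unzip1 /= => E.
have swap12 : perm_eq [:: (x1, x2); (y1, y2); (z1, z2)] [:: (y1, y2); (x1, x2); (z1, z2)].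
  by apply/permP => p /=; lia.
have swap23 : perm_eq [:: (x1, x2); (y1, y2); (z1, z2)] [:: (x1, x2); (z1, z2); (y1, y2)].
  by apply/permP => p /=; lia.
move: pz; rewrite /= /agree /= !andbT => /andP[/andP[/eqP e1 /eqP e2] /eqP e3].
case: k E => x y z h1 h2 [? ? ?]; subst.
- exists [:: (z, y2); (x, x2); (y, z2)]; rewrite /unzip1 /unzip2 /= /agree /=.
  by split=> //; [lia|constructor; lia].
- exists [:: (x, y2); (z, x2); (y, z2)]; rewrite /unzip1 /unzip2 /= /agree /=.
  by split=> //; [lia|constructor; lia].
- exists [:: (y, x2); (z, z2); (x, y2)]; rewrite /unzip1 /unzip2 /= /agree /=.
  by split=> //; [lia|constructor; lia].
- exists [:: (y, x2); (x, z2); (z, y2)]; rewrite /unzip1 /unzip2 /= /agree /=.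
  by split=> //; [lia|constructor; lia].
Qed.

Lemma knuth_agree w w' zs : knuth w w' -> pairwise agree zs -> unzip1 zs = w ->
  exists zs', [/\ unzip1 zs' = w', pairwise agree zs', perm_eq zs zs'
    & knuth (unzip2 zs) (unzip2 zs')].
Proof.
move=> k; elim: k zs => [w1|u a a' v w1 k _ IH] zs pz E.
  by exists zs; split=> //; apply: knuth_refl.
have [zu [zr [Ez Eu /map_eq_cat[za [zv [Er Ea Ev]]]]]] := map_eq_cat E.
subst zs zr; move: pz; rewrite !pairwise_cat => /and3P[r1 pu /and3P[r2 pa pv]].
have [za' [Ea' pa' pm ka]] := knuth_triple_agree k pa Ea.
have [||zs' [E' p' pm' k']] := IH (zu ++ za' ++ zv).
- rewrite !pairwise_cat pu pv pa' !andbT; apply/andP; split.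
    by move: r1; rewrite !allrel_catr (eq_allrel_memr _ _ (perm_mem pm)).
  by rewrite -(eq_allrel_meml _ _ (perm_mem pm)).
- by rewrite /unzip1 !map_cat; congr (_ ++ (_ ++ _)).
exists zs'; split=> //.
  by apply: perm_trans pm'; rewrite perm_cat2l perm_cat2r.
apply: knuth_trans k'; rewrite /unzip2 !map_cat; exact: knuth_core.
Qed.

(** * Shapes of suffixes *)

(** The upper row is read before the lower one, so weak increase along rows is the absence of
    inversions and strict increase up columns is their presence; both words share these. *)
Lemma sst_agree_rows ss (tz : seq (seq (nat * nat))) :
  sst ss (map (@unzip1 _ _) tz) -> pairwise agree (flatten (rev tz)) ->
  sst ss (map (@unzip2 _ _) tz).
Proof.
elim: tz ss => //= Y tz IH ss /and4P[sY dY zY st].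
rewrite rev_cons flatten_rcons pairwise_cat => /and3P[aY pt pY].
rewrite (IH _ st pt) andbT; apply/and3P; split.
- move: sY pY; rewrite !(sorted_pairwise leq_trans) /unzip1 /unzip2 !pairwise_map.
  move=> sY pY; have := conj sY pY => /andP; rewrite -pairwise_relI.
  by apply: sub_pairwise => a b /=; rewrite /agree; lia.
- apply/rowdomP => j; rewrite !size_map => jY.
  case: tz {IH st zY} pt aY dY => //= X tz _ aY dY; rewrite size_map => jX.
  have := rowdomP _ _ _ dY j; rewrite !size_map => /(_ jY jX).
  rewrite !(nth_map (0, 0)) // => h.
  have := allrelP aY (nth (0, 0) X (head 0 ss + j)) (nth (0, 0) Y j).
  rewrite rev_cons flatten_rcons mem_cat !mem_nth // orbT /agree h => /(_ isT isT).
  by move/eqP=> <-.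
- by move: zY; rewrite !size_map; case: (tz) => //= X ?; rewrite !size_map.
Qed.

Lemma sst_agree ss t zs : sst ss t -> unzip1 zs = reading_word t -> pairwise agree zs ->
  exists t', [/\ map size t' = map size t, reading_word t' = unzip2 zs & sst ss t'].
Proof.
move=> st E pz; pose tz := rev (reshape (rev (map size t)) zs).
have szz : size zs = sumn (rev (map size t)).
  by rewrite -(size_map fst) -/(unzip1 zs) E size_flatten /shape map_rev.
have Ez : flatten (rev tz) = zs by rewrite revK reshapeKr // szz.
have Ss : map size tz = map size t.
  by rewrite /tz map_rev -/(shape _) reshapeKl ?szz // revK.
have Et : map (@unzip1 _ _) tz = t.
  apply: reading_word_inj.
    by rewrite -E -Ez /reading_word -map_rev -map_flatten.
  by rewrite -map_comp -Ss; apply: eq_map => r /=; rewrite size_map.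
exists (map (@unzip2 _ _) tz); split.
- by rewrite -map_comp -Ss; apply: eq_map => r /=; rewrite size_map.
- by rewrite -Ez /reading_word -map_rev -map_flatten.
- by apply: sst_agree_rows; rewrite ?Et ?Ez.
Qed.

Definition rsk_shape w := map size (rsk_P w).

(** The moves from the first word to its tableau, applied to the second word, end in a semistandard
    filling of the same shape. *)
Lemma rsk_shape_agree zs : pairwise agree zs -> rsk_shape (unzip1 zs) = rsk_shape (unzip2 zs).
Proof.
move=> pz; have [k /andP[st sz]] := rsk_PP (unzip1 zs).
have [zs' [E pz' _ k']] := knuth_agree k pz erefl.
have [t' [S E' st']] := sst_agree st E pz'.
rewrite /rsk_shape (rsk_P_knuth k') -E' rsk_P_reading ?S //.
by rewrite /straight st' S.
Qed.

Lemma rsk_shape_cf i w : rsk_shape (cf i w) = rsk_shape w.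
Proof.
have [k /andP[st sz]] := rsk_PP w; have [_ _ kf _] := knuth_crystal i k.
have [t' [E S st' _]] := cf_sst i st.
by rewrite /rsk_shape (rsk_P_knuth kf) -E rsk_P_reading ?S // /straight st' S.
Qed.

(* Equality of the shapes of all suffixes plays the role of equality of
   recording tableaux. *)
Definition suffix_eq (w w' : seq nat) :=
  size w = size w' /\ forall k, rsk_shape (drop k w) = rsk_shape (drop k w').

Lemma suffix_eq_sym w w' : suffix_eq w w' -> suffix_eq w' w.
Proof. by case=> h1 h2; split=> [|k]; rewrite ?h2. Qed.

Lemma suffix_eq_trans w1 w2 w3 : suffix_eq w1 w2 -> suffix_eq w2 w3 -> suffix_eq w1 w3.
Proof. by case=> h1 h2 [h3 h4]; split=> [|k]; rewrite ?h1 // h2. Qed.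

(** By [cf_cat] each suffix of [cf i w] is the suffix of [w] or its image under [cf i]. *)
Lemma suffix_eq_cf i w : suffix_eq w (cf i w).
Proof.
split=> [|k]; first by rewrite size_cf.
have [h|h] := leqP (size w) k; first by rewrite !drop_oversize ?size_cf.
rewrite -[in RHS](cat_take_drop k w) cf_cat.
have sk : size (take k w) = k by rewrite size_take h.
by case: ifP => _; rewrite drop_size_cat ?size_cf // rsk_shape_cf.
Qed.

Lemma suffix_eq_ce i w : suffix_eq w (ce i w).
Proof.
have [/ce_eps0->//|h] := posnP (ceps i w).
by have [e _ _] := ceP h; rewrite -{1}e; apply: suffix_eq_sym; apply: suffix_eq_cf.
Qed.

Lemma suffix_eq_agree zs : pairwise agree zs -> suffix_eq (unzip1 zs) (unzip2 zs).
Proof.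
move=> pz; split=> [|k]; first by rewrite !size_map.
rewrite -!map_drop; apply: rsk_shape_agree.
by move: pz; rewrite -{1}(cat_take_drop k zs) pairwise_cat => /and3P[].
Qed.

Lemma hw_count w : highest_weight w -> forall r, count_mem r w = nth 0 (rsk_shape w) r.
Proof.
move=> h r; have [k st] := rsk_PP w.
rewrite /rsk_shape -(hw_straight st _).2; last by move=> i; have [_ <- ] := knuth_crystal i k.
by have /permP := knuth_perm k; apply.
Qed.

Lemma hw_suffix_eq_eq u u' : highest_weight u -> highest_weight u' -> suffix_eq u u' -> u = u'.
Proof.
elim: u u' => [|x u IH] [|x' u'] h h' [] //= [sz] H.
have hu : highest_weight u by move=> i; have := h i; rewrite /=; lia.
have hu' : highest_weight u' by move=> i; have := h' i; rewrite /=; lia.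
have E : u = u' by apply: IH => //; split=> // k; apply: (H k.+1).
have := hw_count h x; have := hw_count h' x.
have := H 0; rewrite !drop0 => <- <-; rewrite E /= eqxx.
by case: eqP => [->//|_]; lia.
Qed.

Lemma knuth_suffix_eq_eq w w' : knuth w w' -> suffix_eq w w' -> w = w'.
Proof.
have [n] := ubnP (sumn w); elim: n w w' => // n IH w w' wn k r.
have [h|[i h]] := hwVe w.
  by apply: hw_suffix_eq_eq => // i; have [_ <-] := knuth_crystal i k.
have [_ e _ k'] := knuth_crystal i k.
have h' : 0 < ceps i w' by rewrite -e.
have [<- _ _] := ceP h; have [<- _ _] := ceP h'; congr (cf i _); apply: IH => //.
  by have := sumn_ce h; lia.
exact: suffix_eq_trans (suffix_eq_sym (suffix_eq_ce i w)) (suffix_eq_trans r (suffix_eq_ce i w')).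
Qed.

(** Tableaux of equal shape are raised to the same highest weight tableau. The outer induction
    raises [w0] along with [t0]; the inner one raises [t] and follows it back down with [cf],
    staying in the suffix class. *)
Lemma knuth_suffix_eq_exists w0 t0 t : straight t0 -> straight t -> map size t0 = map size t ->
  knuth w0 (reading_word t0) -> exists2 w, knuth w (reading_word t) & suffix_eq w0 w.
Proof.
have [n] := ubnP (sumn (reading_word t0)).
elim: n w0 t0 => // n IH w0 t0 tn s0 st sz k0.
have [h0|[i h0]] := hwVe (reading_word t0); last first.
  have [u [E S su]] := straight_ce i s0; have [_ _ _ k1] := knuth_crystal i k0.
  have [|||||w kw rw] := IH (ce i w0) u.
  - by rewrite E; have := sumn_ce h0; lia.
  - by [].
  - by [].
  - by rewrite S.
  - by rewrite E.
  by exists w => //; apply: suffix_eq_trans rw; apply: suffix_eq_ce.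
have [m] := ubnP (sumn (reading_word t)).
clear IH; elim: m t st sz => // m IHm t st sz tm.
have [h|[i h]] := hwVe (reading_word t).
  by exists w0 => //; rewrite -(hw_straight_inj s0 st).
have [u [E S su]] := straight_ce i st.
have [|||w kw rw] := IHm u => //; first by rewrite S.
  by rewrite E; have := sumn_ce h; lia.
have [_ _ kf _] := knuth_crystal i kw.
exists (cf i w); last by apply: suffix_eq_trans rw (suffix_eq_cf i w).
by apply: knuth_trans kf _; rewrite E; have [-> _ _] := ceP h; apply: knuth_refl.
Qed.

Definition skew_word ss shp w :=
  exists t, [/\ sst ss t, map size t = shp & reading_word t = w].

Lemma skew_word_suffix_eq ss shp w w' : skew_word ss shp w -> suffix_eq w w' -> skew_word ss shp w'.
Proof.
have [n] := ubnP (sumn w + sumn w'); elim: n w w' => // n IH w w' wn [t [st sz E]] r.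
have [h|[i h]] := hwVe w; last first.
  apply: (IH (ce i w)); first by have := sumn_ce h; lia.
    by have [t' [E' S' st' _]] := ce_sst i st; exists t'; split; rewrite ?S' // E' E.
  exact: suffix_eq_trans (suffix_eq_sym (suffix_eq_ce i w)) r.
have [h'|[i h']] := hwVe w'; first by rewrite -(hw_suffix_eq_eq h h' r); exists t.
have [|||u [su Su Eu]] := IH w (ce i w').
- by have := sumn_ce h'; lia.
- by exists t.
- exact: suffix_eq_trans r (suffix_eq_ce i w').
have [t' [E' S' st' _]] := cf_sst i su; exists t'; split=> //; first by rewrite S'.
by rewrite E' Eu; have [-> _ _] := ceP h'.
Qed.

(** * Jeu de taquin *)

(** Inserting the letters of [D] one by one into the row [X ++ B ++ Z] bumps exactly the letters of
    [B], in order. *)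
Lemma knuth_slide X B Z D : all2 (fun b d => d < b) B D ->
  sorted leq (X ++ B ++ Z) -> sorted leq (X ++ D) ->
  knuth (X ++ B ++ Z ++ D) (B ++ X ++ D ++ Z).
Proof.
elim: B D X => [|b B IH] [|d D] X //=; first by rewrite !cats0 => *; apply: knuth_refl.
case/andP=> db dB s1 s2.
have E : X ++ b :: B ++ Z ++ d :: D = (X ++ b :: (B ++ Z) ++ [:: d]) ++ D.
  by rewrite -!catA /= -!catA.
have Xd : all (leq^~ d) X.
  move: s2; rewrite (sorted_pairwise leq_trans) pairwise_cat => /and3P[/allrelP h _ _].
  by apply/allP => x xX; apply: h => //; rewrite inE eqxx.
rewrite E; apply: knuth_trans (knuth_catr _ (knuth_bump s1 Xd db)) _.
have {}E : (b :: X ++ d :: B ++ Z) ++ D = [:: b] ++ (rcons X d) ++ B ++ Z ++ D.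
  by rewrite cat_rcons /= -!catA /= -!catA.
have -> : b :: B ++ X ++ (d :: D) ++ Z = [:: b] ++ B ++ rcons X d ++ D ++ Z.
  by rewrite cat_rcons.
rewrite E; apply/knuth_catl/IH => //; last by rewrite cat_rcons.
rewrite cat_rcons; move: s1; rewrite !(sorted_pairwise leq_trans) !pairwise_cat /=.
rewrite allrel_consr => /and3P[/andP[h1 h2] -> /andP[h3 ->]].
rewrite allrel_consr h2 Xd !andbT /=.
by apply: sub_all h3 => z /=; lia.
Qed.

(** A vertical slide on two rows: [y] drops into the hole between [C] and [D1], with [A2] above [C]
    and [B] above [D1]. Inserting [C] bumps [A2] and leaves [y] between [C] and [B]; inserting [D1]
    then bumps [B]. *)
Lemma knuth_vslide A1 A2 y B C D1 D2 : all2 (fun b d => d < b) A2 C ->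
  all2 (fun b d => d < b) B D1 -> sorted leq (A1 ++ A2 ++ y :: B) ->
  sorted leq (C ++ y :: D1 ++ D2) ->
  knuth ((A1 ++ A2 ++ y :: B) ++ C ++ D1 ++ D2) ((A1 ++ A2 ++ B) ++ C ++ y :: D1 ++ D2).
Proof.
move=> h1 h2 s1 s2; rewrite -!catA; apply: knuth_catl.
have sA : sorted leq (A2 ++ y :: B).
  by apply: (subseq_sorted leq_trans) s1; apply: suffix_subseq.
have sC : sorted leq C by apply: (subseq_sorted leq_trans) s2; apply: prefix_subseq.
have k1 := @knuth_slide [::] A2 (y :: B) C h1 sA sC.
have -> : A2 ++ (y :: B) ++ C ++ D1 ++ D2 = (A2 ++ (y :: B) ++ C) ++ D1 ++ D2.
  by rewrite -!catA.
apply: knuth_trans (knuth_catr (D1 ++ D2) k1) _; rewrite /= -!catA; apply: knuth_catl.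
have k2 := @knuth_slide (rcons C y) B [::] D1 h2.
rewrite !cats0 !cat_rcons /= in k2.
have -> : C ++ (y :: B) ++ D1 ++ D2 = (C ++ y :: B ++ D1) ++ D2.
  by rewrite -!catA /= -!catA.
have -> : B ++ C ++ y :: D1 ++ D2 = (B ++ C ++ y :: D1) ++ D2 by rewrite -!catA.
apply/knuth_catr/k2.
  move: sA s2; rewrite !(sorted_pairwise leq_trans) !pairwise_cat /=.
  rewrite !allrel_consr => /and3P[_ _ /andP[yB ->]] /and3P[/andP[Cy _] -> _].
  rewrite yB Cy !andbT /=; apply/allrelP => c z cC zB.
  exact: leq_trans (allP Cy _ cC) (allP yB _ zB).
move: s2; rewrite !(sorted_pairwise leq_trans) !pairwise_cat /= !allrel_consr all_cat.
rewrite allrel_catr pairwise_cat.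
by case/and3P=> /andP[-> /andP[-> _]] -> /andP[/andP[-> _] /and3P[_ -> _]].
Qed.

(** Empty cells are skipped; [L] and [M] bound the rows and columns of a box that contains the
    filling during all slides. *)
Definition frow M (f : filling) r := pmap (fun c => f (r, c)) (iota 0 M).
Definition fword L M (f : filling) := reading_word (mkseq (frow M f) L).

(** Distant cells are compared too, since a hole may separate them. *)
Definition incr_filling (f : filling) :=
  (forall r c c' x x', c < c' -> f (r, c) = Some x -> f (r, c') = Some x' -> x < x') /\
  (forall r r' c x x', r < r' -> f (r, c) = Some x -> f (r', c) = Some x' -> x < x').

Definition in_skew (nu la : nat -> nat) (p : cell) := nu p.1 <= p.2 < la p.1.

Definition antimono (nu : nat -> nat) := forall r, nu r.+1 <= nu r.

Lemma antimonoP nu r r' : antimono nu -> r <= r' -> nu r' <= nu r.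
Proof.
move=> h; elim: r' => [|r' IH]; first by rewrite leqn0 => /eqP->.
by rewrite leq_eqVlt => /orP[/eqP->//|/IH]; apply: leq_trans.
Qed.

Lemma in_skew_between nu la r1 c1 r2 c2 r c : antimono nu -> antimono la ->
  in_skew nu la (r1, c1) -> in_skew nu la (r2, c2) ->
  r1 <= r <= r2 -> c1 <= c <= c2 -> in_skew nu la (r, c).
Proof.
rewrite /in_skew /= => hn hl h1 h2 /andP[r1r rr2] hc.
by have := antimonoP hn r1r; have := antimonoP hl rr2; lia.
Qed.

(** The state during a slide: the filled cells and the hole [h] together form the skew shape between
    [nu] and [la]. *)
Definition hole_inv nu la (f : filling) (h : cell) :=
  [/\ f h = None, forall p, (f p != None) || (p == h) = in_skew nu la p
    & incr_filling f].

Lemma hole_def nu la f h p : hole_inv nu la f h -> in_skew nu la p -> p <> h ->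
  exists x, f p = Some x.
Proof.
case=> _ H _; rewrite -H => /orP[|/eqP//]; case: (f p) => // x _ _; by exists x.
Qed.

Lemma hole_in nu la f h p x : hole_inv nu la f h -> f p = Some x -> in_skew nu la p.
Proof. by case=> _ H _ e; rewrite -H e. Qed.

Lemma hole_skew nu la f h : hole_inv nu la f h -> in_skew nu la h.
Proof. by case=> _ H _; rewrite -H eqxx orbT. Qed.

Lemma updE f p v q : upd f p v q = if q == p then v else f q. Proof. by []. Qed.

Lemma hole_right nu la f r c x : antimono nu -> antimono la ->
  hole_inv nu la f (r, c) -> f (r, c.+1) = Some x ->
  (forall y, f (r.+1, c) = Some y -> x < y) ->
  hole_inv nu la (upd (upd f (r, c) (Some x)) (r, c.+1) None) (r, c.+1).
Proof.
move=> hn hl hi ex hy; have [h0 hd [hr hc]] := hi.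
have ih := hole_skew hi; have ix := hole_in hi ex.
split; first by rewrite updE eqxx.
  move=> p; rewrite !updE; case: (p =P (r, c.+1)) => [->|np]; first by rewrite ix orbT.
  case: (p =P (r, c)) => [->|/eqP/negbTE np']; first by rewrite ih.
  by rewrite -hd np'.
split.
  move=> s j j' u v jj; rewrite !updE !xpair_eqE.
  case: (s =P r) => [->|] /=; last by move=> _; apply: hr.
  case: (j =P c.+1) => [//|nj]; case: (j' =P c.+1) => [//|nj'].
  case: (j =P c) => [ejc|nj2]; case: (j' =P c) => [ej|nj2'] //; first by lia.
  - by case=> <-; apply: hr ex; lia.
  - by move=> fu [<-]; apply: hr fu ex; lia.
  - exact: hr.
move=> s s' j u v ss; rewrite !updE !xpair_eqE.
case: (j =P c.+1) => [->|nj] /=.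
  rewrite !andbT; have -> : (c.+1 == c) = false by lia.
  by rewrite !andbF; case: eqP => // _; case: eqP => // _; apply: hc.
rewrite !andbF; case: (j =P c) => [->|nj2]; last by rewrite !andbF; apply: hc.
rewrite !andbT; case: (s =P r) => [es|ns]; case: (s' =P r) => [es'|ns'] //; first by lia.
- case=> <- fv; have iv := hole_in hi fv.
  (* The cell above the old hole is filled by convexity of the skew shape, and [x] is smaller than
     its entry by the choice of the slide. *)
  have [y ey] : exists y, f (r.+1, c) = Some y.
    apply: (hole_def hi); last by case; lia.
    by apply: (in_skew_between hn hl ih iv); lia.
  have xy := hy _ ey; case: (s' =P r.+1) => [e|ne].
    by move: fv; rewrite e ey => -[<-].
  by apply: ltn_trans xy _; apply: hc ey fv; lia.
- move=> fu [<-]; have iu := hole_in hi fu.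
  (* The comparison with a lower cell of column [c] goes through its right neighbour, filled by
     convexity. *)
  have [y ey] : exists y, f (s, c.+1) = Some y.
    apply: (hole_def hi); last by case; lia.
    by apply: (in_skew_between hn hl iu ix); lia.
  by apply: (@ltn_trans y); [apply: hr fu ey|apply: hc ey ex; lia].
- exact: hc.
Qed.

Lemma hole_up nu la f r c y : antimono nu -> antimono la ->
  hole_inv nu la f (r, c) -> f (r.+1, c) = Some y ->
  (forall x, f (r, c.+1) = Some x -> y < x) ->
  hole_inv nu la (upd (upd f (r, c) (Some y)) (r.+1, c) None) (r.+1, c).
Proof.
move=> hn hl hi ey hx; have [h0 hd [hr hc]] := hi.
have ih := hole_skew hi; have iy := hole_in hi ey.
split; first by rewrite updE eqxx.
  move=> p; rewrite !updE; case: (p =P (r.+1, c)) => [->|np]; first by rewrite iy orbT.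
  case: (p =P (r, c)) => [->|/eqP/negbTE np']; first by rewrite ih.
  by rewrite -hd np'.
split; last first.
  move=> s s' j u v ss; rewrite !updE !xpair_eqE.
  case: (j =P c) => [->|] /=; last by move=> _; rewrite !andbF; apply: hc.
  rewrite !andbT; case: (s =P r.+1) => [//|nj]; case: (s' =P r.+1) => [//|nj'].
  case: (s =P r) => [esr|nj2]; case: (s' =P r) => [ej|nj2'] //; first by lia.
  - by case=> <-; apply: hc ey; lia.
  - by move=> fu [<-]; apply: hc fu ey; lia.
  - exact: hc.
move=> s j j' u v jj; rewrite !updE !xpair_eqE.
case: (s =P r.+1) => [->|ns] /=.
  have -> : (r.+1 == r) = false by lia.
  by case: eqP => // _; case: eqP => // _; apply: hr.
case: (s =P r) => [->|ns2] /=; last exact: hr.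
case: (j =P c) => [es|nj]; case: (j' =P c) => [es'|nj'] //; first by lia.
- case=> <- fv; have iv := hole_in hi fv.
  have [x ex] : exists x, f (r, c.+1) = Some x.
    apply: (hole_def hi); last by case; lia.
    by apply: (in_skew_between hn hl ih iv); lia.
  have xy := hx _ ex; case: (j' =P c.+1) => [e|ne].
    by move: fv; rewrite e ex => -[<-].
  by apply: ltn_trans xy _; apply: hr ex fv; lia.
- move=> fu [<-]; have iu := hole_in hi fu.
  have [x ex] : exists x, f (r.+1, j) = Some x.
    apply: (hole_def hi); last by case; lia.
    by apply: (in_skew_between hn hl iu iy); lia.
  by apply: (@ltn_trans x); [apply: hc fu ex|apply: hr ex ey; lia].
- exact: hr.
Qed.

Lemma pmap_none (g : nat -> option nat) s : (forall c, c \in s -> g c = None) -> pmap g s = [::].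
Proof.
elim: s => //= c s IH h; rewrite h ?inE ?eqxx //= IH // => d ds.
by apply: h; rewrite inE ds orbT.
Qed.

Lemma eq_in_pmap_seq (g g' : nat -> option nat) s : {in s, g =1 g'} -> pmap g s = pmap g' s.
Proof.
elim: s => //= c s IH h; rewrite h ?inE ?eqxx //= IH // => d ds.
by apply: h; rewrite inE ds orbT.
Qed.

Lemma pmap_all2 (g g' : nat -> option nat) s :
  (forall c, c \in s -> exists x y, [/\ g c = Some x, g' c = Some y & y < x]) ->
  all2 (fun b d => d < b) (pmap g s) (pmap g' s).
Proof.
elim: s => //= c s IH h; have [|x [y [-> -> xy]]] := h c; first by rewrite inE eqxx.
rewrite /= xy IH // => d ds; apply: h; by rewrite inE ds orbT.
Qed.

Lemma sorted_pmap (g : nat -> option nat) s :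
  (forall c c' x x', c < c' -> g c = Some x -> g c' = Some x' -> x < x') ->
  sorted ltn s -> sorted ltn (pmap g s).
Proof.
move=> H; rewrite !(sorted_pairwise ltn_trans); elim: s => //= c s IH /andP[cs ps].
case E: (g c) => [x|] /=; last exact: IH.
rewrite IH // andbT; apply/allP => y; rewrite mem_pmap => /mapP[d ds /esym e].
exact: H (allP cs _ ds) E e.
Qed.

Lemma sorted_frow M f r : incr_filling f -> sorted leq (frow M f r).
Proof.
case=> h _; apply: (sub_sorted (e := ltn)); first by move=> x y /ltnW.
by apply: sorted_pmap (iota_ltn_sorted _ _) => c c' x x'; apply: h.
Qed.

Lemma iota_split n k : k < n -> iota 0 n = iota 0 k ++ k :: iota k.+1 (n - k.+1).
Proof.
move=> h; have -> : n = k + (n - k.+1).+1 by lia.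
by rewrite iotaD /= add0n; congr (_ ++ _ :: iota _ _); lia.
Qed.

Lemma iota_split2 n k : k.+1 < n ->
  iota 0 n = iota 0 k ++ k :: k.+1 :: iota k.+2 (n - k.+2).
Proof.
by move=> h; rewrite (iota_split (ltnW h)) -(subnSK h).
Qed.

(** A horizontal slide is invisible in the reading word, because [frow] skips the hole. *)
Lemma frow_right M f r c x s : c.+1 < M -> f (r, c) = None -> f (r, c.+1) = Some x ->
  frow M (upd (upd f (r, c) (Some x)) (r, c.+1) None) s = frow M f s.
Proof.
move=> cM e0 ex; rewrite /frow.
case: (s =P r) => [->|ns]; last first.
  by apply: eq_pmap => j; rewrite !updE !xpair_eqE; case: eqP ns.
rewrite (iota_split2 cM) !pmap_cat /= !updE !xpair_eqE !eqxx /=.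
have -> : (c == c.+1) = false by lia.
rewrite e0 ex /=; congr (_ ++ _ :: _).
  apply: eq_in_pmap_seq => j; rewrite mem_iota !updE !xpair_eqE eqxx /= => h.
  by do 2![case: eqP => ?; first lia].
apply: eq_in_pmap_seq => j; rewrite mem_iota !updE !xpair_eqE eqxx /= => h.
by do 2![case: eqP => ?; first lia].
Qed.

Lemma knuth_up nu la L M f r c y : antimono nu -> antimono la ->
  la 0 <= M -> (forall s, L <= s -> la s = 0) ->
  hole_inv nu la f (r, c) -> f (r.+1, c) = Some y ->
  (forall x, f (r, c.+1) = Some x -> y < x) ->
  knuth (fword L M f) (fword L M (upd (upd f (r, c) (Some y)) (r.+1, c) None)).
Proof.
move=> hn hl lM lL hi ey hx; have hi' := hole_up hn hl hi ey hx.
set f' := upd _ _ _ in hi' *; have [h0 hd [hr hc]] := hi; have [h0' _ inc'] := hi'.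
have iy := hole_in hi ey; have ih := hole_skew hi.
have laM s : la s <= M by apply: leq_trans lM; apply: antimonoP.
have rL : r.+1 < L.
  by rewrite ltnNge; apply/negP => /lL e; move: iy; rewrite /in_skew /= e ltn0 andbF.
have cM : c < M by move: iy (laM r.+1); rewrite /in_skew /=; lia.
have frowE s : s != r -> s != r.+1 -> frow M f' s = frow M f s.
  move=> s1 s2; apply: eq_pmap => j; rewrite /f' !updE !xpair_eqE.
  by rewrite (negbTE s1) (negbTE s2).
rewrite /fword /mkseq (iota_split2 rL) !map_cat /= /reading_word !rev_cat !rev_cons.
rewrite !flatten_cat !flatten_rcons -!catA.
have -> : map (frow M f') (iota 0 r) = map (frow M f) (iota 0 r).
  by apply/eq_in_map => s; rewrite mem_iota => hs; apply: frowE; lia.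
have -> : map (frow M f') (iota r.+2 (L - r.+2)) = map (frow M f) (iota r.+2 (L - r.+2)).
  by apply/eq_in_map => s; rewrite mem_iota => hs; apply: frowE; lia.
apply: knuth_catl; rewrite !catA; apply: knuth_catr.
(* The lower row is taken after the slide, so that its sortedness includes [y]. *)
have s1 := sorted_frow M r.+1 (conj hr hc); have s2 := sorted_frow M r inc'.
(* Row [r] begins in column [c1] and row [r + 1] ends before [c2]. Cutting there and at [c] gives
   the blocks of [knuth_vslide]: of the two rows, only the upper has cells before [c1] and only the
   lower from [c2] on. *)
pose c1 := nu r; pose c2 := la r.+1.
have c1c : c1 <= c by move: ih; rewrite /in_skew /=; lia.
have c2c : c < c2 <= M by move: iy (laM r.+1); rewrite /in_skew /=; lia.
have E : iota 0 M = iota 0 c1 ++ iota c1 (c - c1) ++ c :: iota c.+1 (c2 - c.+1) ++ iota c2 (M - c2).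
  rewrite (iota_split cM) catA; congr (_ ++ _ :: _).
    by rewrite -[in RHS](add0n c1) -iotaD; congr iota; lia.
  have -> : iota c2 (M - c2) = iota (c.+1 + (c2 - c.+1)) (M - c2) by congr iota; lia.
  by rewrite -iotaD; congr iota; lia.
have Er1 : frow M f r.+1 = pmap (fun j => f (r.+1, j)) (iota 0 c1) ++
    pmap (fun j => f (r.+1, j)) (iota c1 (c - c1)) ++
    y :: pmap (fun j => f (r.+1, j)) (iota c.+1 (c2 - c.+1)).
  rewrite /frow E !pmap_cat /= ey /= pmap_cat [pmap _ (iota c2 _)]pmap_none ?cats0 //.
  move=> j; rewrite mem_iota => hj; apply/eqP; apply/negP => hf.
  by have := hd (r.+1, j); rewrite /in_skew /= (introN idP hf) /=; lia.
have Er : frow M f r = pmap (fun j => f (r, j)) (iota c1 (c - c1)) ++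
    pmap (fun j => f (r, j)) (iota c.+1 (c2 - c.+1)) ++ pmap (fun j => f (r, j)) (iota c2 (M - c2)).
  rewrite /frow E !pmap_cat /= h0 /= pmap_cat [pmap _ (iota 0 c1)]pmap_none //.
  move=> j; rewrite mem_iota => hj; apply/eqP; apply/negP => hf.
  by have := hd (r, j); rewrite /in_skew /= (introN idP hf) /=; lia.
have Fr1 j : j != c -> f' (r.+1, j) = f (r.+1, j).
  by move=> nj; rewrite /f' !updE !xpair_eqE (negbTE nj) !andbF.
have Fr j : j != c -> f' (r, j) = f (r, j).
  by move=> nj; rewrite /f' !updE !xpair_eqE (negbTE nj) !andbF.
have Fc1 : f' (r.+1, c) = None by rewrite /f' updE eqxx.
have Fc : f' (r, c) = Some y.
  by rewrite /f' !updE !xpair_eqE !eqxx; have -> : (r == r.+1) = false by lia.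
have Er1' : frow M f' r.+1 = pmap (fun j => f (r.+1, j)) (iota 0 c1) ++
    pmap (fun j => f (r.+1, j)) (iota c1 (c - c1)) ++
    pmap (fun j => f (r.+1, j)) (iota c.+1 (c2 - c.+1)).
  rewrite /frow E !pmap_cat /= Fc1 /= pmap_cat [pmap _ (iota c2 _)]pmap_none ?cats0.
    congr (_ ++ (_ ++ _)); apply: eq_in_pmap_seq => j; rewrite mem_iota => hj;
    by apply: Fr1; lia.
  move=> j; rewrite mem_iota => hj; rewrite Fr1; last by lia.
  apply/eqP; apply/negP => hf.
  by have := hd (r.+1, j); rewrite /in_skew /= (introN idP hf) /=; lia.
have Er' : frow M f' r = pmap (fun j => f (r, j)) (iota c1 (c - c1)) ++ y ::
    pmap (fun j => f (r, j)) (iota c.+1 (c2 - c.+1)) ++ pmap (fun j => f (r, j)) (iota c2 (M - c2)).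
  rewrite /frow E !pmap_cat /= Fc /= pmap_cat [pmap _ (iota 0 c1)]pmap_none.
    congr (_ ++ _ :: (_ ++ _)); apply: eq_in_pmap_seq => j; rewrite mem_iota => hj;
    by apply: Fr; lia.
  move=> j; rewrite mem_iota => hj; rewrite Fr; last by lia.
  apply/eqP; apply/negP => hf.
  by have := hd (r, j); rewrite /in_skew /= (introN idP hf) /=; lia.
rewrite Er1 Er' in s1 s2; rewrite Er1 Er Er1' Er'.
have both j : j != c -> c1 <= j < c2 ->
    exists x z, [/\ f (r.+1, j) = Some x, f (r, j) = Some z & z < x].
  move=> nj hj; have n1 := hn r; have n2 := hl r.
  have [x ex] : exists x, f (r.+1, j) = Some x.
    by apply: (hole_def hi); [rewrite /in_skew /=; lia|case; lia].
  have [z ez] : exists z, f (r, j) = Some z.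
    apply: (hole_def hi); last by case=> e; move: nj; rewrite e eqxx.
    by rewrite /in_skew /=; lia.
  by exists x, z; split=> //; apply: hc ez ex.
apply: knuth_vslide => //; apply: pmap_all2 => j; rewrite mem_iota => hj; apply: both; lia.
Qed.

Lemma slide_outP nu la L M f h g : antimono nu -> antimono la ->
  la 0 <= M -> (forall s, L <= s -> la s = 0) ->
  slide_out f h g -> hole_inv nu la f h ->
  exists r c, [/\ hole_inv nu la g (r, c), g (r, c.+1) = None, g (r.+1, c) = None
    & knuth (fword L M f) (fword L M g)].
Proof.
move=> hn hl lM lL; elim=> {f h g}.
- by move=> f r c e1 e2 hi; exists r, c; split=> //; apply: knuth_refl.
- move=> f r c x g ex hy _ IH hi.
  have [r' [c' [hi' e1 e2 k]]] := IH (hole_right hn hl hi ex hy).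
  exists r', c'; split=> //; apply: knuth_trans k.
  have [h0 _ _] := hi; have := hole_in hi ex; rewrite /in_skew /= => ix.
  have cM : c.+1 < M by have := antimonoP hl (leq0n r); lia.
  rewrite /fword /mkseq (eq_map (fun s => frow_right s cM h0 ex)).
  exact: knuth_refl.
- move=> f r c y g ey hx _ IH hi.
  have [r' [c' [hi' e1 e2 k]]] := IH (hole_up hn hl hi ey hx).
  exists r', c'; split=> //; apply: knuth_trans k.
  exact: knuth_up hn hl lM lL hi ey hx.
Qed.

Definition skew_filling nu la (f : filling) :=
  [/\ antimono nu, antimono la, forall r, nu r <= la r,
      forall p, (f p != None) = in_skew nu la p & incr_filling f].

(** The chosen inner corner enters the shape as the hole. Where the slide stops, the right and upper
    neighbours are empty, so the hole is an outer corner and leaves the shape. *)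
Lemma jdt_stepP L M nu la f nu' f' : la 0 <= M -> (forall s, L <= s -> la s = 0) ->
  jdt_step nu f nu' f' -> skew_filling (nth 0 nu) la f ->
  exists la', [/\ la' 0 <= M, forall s, L <= s -> la' s = 0,
    skew_filling (nth 0 nu') la' f' & knuth (fword L M f) (fword L M f')].
Proof.
move=> lM lL [r [r0 rr -> sl]] [hn hl nl hd inc].
set nu1 := nth 0 (set_nth _ _ _ _).
have E s : nu1 s = if s == r then (nth 0 nu r).-1 else nth 0 nu s.
  by rewrite /nu1 nth_set_nth.
have hn1 : antimono nu1.
  move=> s; rewrite !E; have := hn s.
  case: (s.+1 =P r) => [e1|_]; case: (s =P r) => [e2|_]; first by lia.
  - by rewrite e1; lia.
  - by rewrite e2; lia.
  - by [].
have hi : hole_inv nu1 la f (r, (nth 0 nu r).-1).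
  split=> //.
    by apply/eqP/negP => /negP; rewrite hd /in_skew /=; lia.
  move=> [s c]; rewrite hd /in_skew /= E xpair_eqE.
  by case: (s =P r) => [->|_] /=; [have := nl r; lia|rewrite orbF].
have [s [c [hi' e1 e2 k]]] := slide_outP hn1 hl lM lL sl hi.
have [h0 hd' inc'] := hi'; have := hole_skew hi'; rewrite /in_skew /= => ih.
have n1 : la s <= c.+1.
  by have := hd' (s, c.+1); rewrite e1 xpair_eqE /in_skew /=; lia.
have n2 : la s.+1 <= c.
  have := hd' (s.+1, c); rewrite e2 xpair_eqE /in_skew /=; have := hn1 s; lia.
pose la' q := if q == s then c else la q.
have nl1 q : nu1 q <= la q by rewrite E; case: eqP (nl q) => [->|] //; lia.
exists la'; split=> //.
- by rewrite /la'; case: eqP => // e; move: lM ih; rewrite e; lia.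
- by move=> q qL; rewrite /la'; case: eqP => [e|_]; [move: ih; rewrite -e lL //; lia|apply: lL].
split=> //.
- move=> q; rewrite /la'; have := hl q.
  case: (q.+1 =P s) => [q1|_]; case: (q =P s) => [q2|_]; first by lia.
  + by rewrite q1; lia.
  + by rewrite q2; lia.
  + by [].
- by move=> q; rewrite /la'; case: eqP => [->|_] //; lia.
- move=> [q j]; have := hd' (q, j); rewrite /in_skew /la' /= xpair_eqE.
  case: (q =P s) => [->|_] /=; last by rewrite orbF.
  case: (j =P c) => [->|nj] /=; last by rewrite orbF => ->; lia.
  by rewrite h0 ltnn andbF.
Qed.

Lemma rectifiesP L M nu la f g : la 0 <= M -> (forall s, L <= s -> la s = 0) ->
  rectifies nu f g -> skew_filling (nth 0 nu) la f ->
  exists la', [/\ la' 0 <= M, forall s, L <= s -> la' s = 0,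
    skew_filling (fun=> 0) la' g & knuth (fword L M f) (fword L M g)].
Proof.
move=> lM lL rec; elim: rec la lM lL => {nu f g}.
  move=> nu f a0 la lM lL [hn hl nl hd inc]; exists la; split=> //; last exact: knuth_refl.
  have E r : nth 0 nu r = 0.
    have [rn|rn] := ltnP r (size nu); last by rewrite nth_default.
    by apply/eqP/(all_nthP 0 a0).
  by split=> // p; rewrite hd /in_skew E.
move=> nu f nu' f' g st _ IH la lM lL sk.
have [la1 [m1 l1 sk1 k1]] := jdt_stepP lM lL st sk.
have [la2 [m2 l2 sk2 k2]] := IH _ m1 l1 sk1.
by exists la2; split=> //; apply: knuth_trans k1 k2.
Qed.

Lemma frow_straight M la g r : la r <= M -> skew_filling (fun=> 0) la g ->
  frow M g r = mkseq (fun c => odflt 0 (g (r, c))) (la r).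
Proof.
move=> lM [_ _ _ hd _]; rewrite /frow; have -> : M = la r + (M - la r) by lia.
rewrite iotaD pmap_cat [pmap _ (iota (0 + _) _)]pmap_none ?cats0; last first.
  move=> c; rewrite mem_iota => hc; apply/eqP/negP => /negP.
  by rewrite hd /in_skew /=; lia.
have H : forall c, c \in iota 0 (la r) -> g (r, c) = Some (odflt 0 (g (r, c))).
  move=> c; rewrite mem_iota => hc; have := hd (r, c).
  by rewrite /in_skew /=; case: (g _) => //= /esym; lia.
rewrite /mkseq; elim: (iota _ _) H => //= c s IH h; rewrite {1}h ?inE ?eqxx //=.
by rewrite IH // => d ds; apply: h; rewrite inE ds orbT.
Qed.

Lemma fword_straight L M la g mu : la 0 <= M -> (forall s, L <= s -> la s = 0) ->
  skew_filling (fun=> 0) la g -> shape_of g mu ->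
  exists t, [/\ straight t, map size t = mu & reading_word t = fword L M g].
Proof.
move=> lM lL sk [/andP[_ mu0] hmu]; have [hn hl _ hd [hr hc]] := sk.
have El r : la r = nth 0 mu r.
  have H c : (c < la r) = (c < nth 0 mu r).
    have := hd (r, c); rewrite /in_skew /= => <-; have [h1 h2] := hmu r c.
    by apply/idP/idP => [/eqP/h1|/h2/eqP].
  by apply/eqP; rewrite eqn_leq leqNgt H ltnn /= leqNgt -H ltnn.
have laM s : la s <= M by apply: leq_trans lM; apply: antimonoP.
have muL : size mu <= L.
  rewrite leqNgt; apply/negP => h.
  by have := all_nthP 0 mu0 _ h; rewrite -El lL.
pose t := mkseq (frow M g) (size mu).
have szr r : size (frow M g r) = nth 0 mu r.
  by rewrite (frow_straight (laM r) sk) size_mkseq El.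
have St : map size t = mu.
  apply: (eq_from_nth (x0 := 0)); first by rewrite size_map size_mkseq.
  rewrite size_map size_mkseq => r rm.
  by rewrite (nth_map [::]) ?size_mkseq // nth_mkseq.
have tr r : nth [::] t r = frow M g r.
  have [rm|rm] := ltnP r (size mu); first by rewrite nth_mkseq.
  by rewrite nth_default ?size_mkseq //; apply/esym/size0nil; rewrite szr nth_default.
exists t; split=> //; last first.
  rewrite /fword /mkseq -(subnKC muL) iotaD map_cat /reading_word rev_cat flatten_cat.
  rewrite [X in _ = X ++ _](_ : _ = [::]) //.
  apply: size0nil; rewrite size_flatten /shape map_rev sumn_rev -map_comp add0n.
  have /all_pred1P-> : all (pred1 0) (map (size \o frow M g) (iota (size mu) (L - size mu))).
    apply/allP => _ /mapP[r rm ->]; rewrite /= szr nth_default //.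
    by move: rm; rewrite mem_iota; lia.
  by rewrite sumn_nseq.
rewrite /straight St mu0 andbT.
suff H s u : (forall r, nth [::] u r = frow M g (s + r)) -> sst [::] u by apply: (H 0).
elim: u s => //= Y u IH s H.
have EX : head [::] u = frow M g s.+1 by have := H 1; rewrite /= addn1 -nth0.
have EY : Y = frow M g s by have := H 0; rewrite addn0.
rewrite (IH s.+1) ?andbT; last by move=> r; have := H r.+1; rewrite /= addnS.
rewrite EX EY !szr add0n -!El hl sorted_frow //= andbT.
apply/rowdomP => j; rewrite !szr -!El add0n => jY jX.
rewrite !(frow_straight (laM _) sk) !nth_mkseq //.
have := hd (s, j); have := hd (s.+1, j); rewrite /in_skew /= jY jX.
by case E1: (g _) => [x|] //; case E2: (g _) => [y|] // _ _ /=; apply: hc E2 E1.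
Qed.

(** * Restriction of a standard tableau to an interval *)

(** Turns conditions on entries into conditions on columns: the entries below [a] come first. *)
Lemma sorted_count_lt row a c : sorted ltn row -> c < size row ->
  (nth 0 row c < a) = (c < count (fun x => x < a) row).
Proof.
elim: row c => //= x row IH c px; have := order_path_min ltn_trans px => /allP gx.
case: (ltnP x a) => xa; last first.
  have -> : count (fun x => x < a) row = 0.
    apply/eqP; rewrite -leqn0 leqNgt -has_count; apply/hasPn => y /gx /=; lia.
  case: c => [|c] /= cs; first by lia.
  by have := gx _ (mem_nth 0 cs); rewrite /=; lia.
by case: c => [|c] //= cs; rewrite IH ?(path_sorted px) //; lia.
Qed.

Section Restriction.

Variables (lam : seq nat) (T : tableau) (a b : nat).
Hypothesis sytT : is_SYT lam T.

(** Row [r] of the restriction occupies the columns from [low r] up to, but excluding, [upp r]. *)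
Let low r := count (fun x => x < a) (nth [::] T r).
Let upp r := count (fun x => x < b.+1) (nth [::] T r).

Lemma SYT_row_sorted r : sorted ltn (nth [::] T r).
Proof.
case: sytT => _ _ sT _ _; have [h|h] := ltnP r (size T); last by rewrite nth_default.
exact: (all_nthP [::] sT).
Qed.

Lemma SYT_row_size r : size (nth [::] T r.+1) <= size (nth [::] T r).
Proof.
case: sytT => /andP[sl _] ES _ _ _.
have E q : size (nth [::] T q) = nth 0 lam q.
  rewrite -ES; have [h|h] := ltnP q (size T); first by rewrite (nth_map [::]).
  by rewrite !nth_default ?size_map.
rewrite !E; have [h|h] := ltnP r.+1 (size lam); last by rewrite (nth_default 0 h).
exact: (sortedP 0 sl).
Qed.

Lemma SYT_count_antimono d : antimono (fun r => count (fun x => x < d) (nth [::] T r)).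
Proof.
move=> r; apply: leq_count_nth => q qr h; split.
  exact: leq_trans qr (SYT_row_size r).
by case: sytT => _ _ _ hc _; apply: ltn_trans (hc _ _ qr) h.
Qed.

Lemma SYT_col r r' c : r < r' -> c < size (nth [::] T r') ->
  nth 0 (nth [::] T r) c < nth 0 (nth [::] T r') c.
Proof.
case: sytT => _ _ _ hc _; elim: r' => // r' IH; rewrite ltnS leq_eqVlt.
case/orP=> [/eqP->|rr] cr; first exact: hc.
by apply: ltn_trans (hc _ _ cr); apply: IH => //; apply: leq_trans (SYT_row_size r').
Qed.

Lemma restr_skew : a <= b -> skew_filling (nth 0 (restr_inner T a)) upp (restr T a b).
Proof.
move=> ab.
have E r : nth 0 (restr_inner T a) r = low r.
  rewrite /low /restr_inner; have [h|h] := ltnP r (size T); first by rewrite (nth_map [::]).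
  by rewrite !nth_default ?size_map.
have uppS r : upp r <= size (nth [::] T r) by apply: count_size.
split.
- by move=> r; rewrite !E; apply: SYT_count_antimono.
- exact: SYT_count_antimono.
- by move=> r; rewrite E; apply: sub_count => x /=; lia.
- move=> [r c]; rewrite /restr /in_skew /= E.
  have [cr|cr] := ltnP c (size (nth [::] T r)); last first.
    by rewrite /= ltnNge (leq_trans (uppS r) cr) andbF.
  have := sorted_count_lt a (SYT_row_sorted r) cr.
  have := sorted_count_lt b.+1 (SYT_row_sorted r) cr.
  by rewrite -/(low r) -/(upp r) /=; case: ifP => /=; lia.
split.
  move=> r c c' x x' cc; rewrite /restr /=; case: ifP => // /andP[h1 _] [<-].
  case: ifP => // /andP[h2 _] [<-].
  by apply: (sorted_ltn_nth ltn_trans 0 (SYT_row_sorted r)) => //; rewrite inE.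
move=> r r' c x x' rr; rewrite /restr /=; case: ifP => // /andP[h1 _] [<-].
by case: ifP => // /andP[h2 _] [<-]; apply: SYT_col.
Qed.

Lemma pmap_nth_filter (P : pred nat) row M : size row <= M ->
  pmap (fun c => if (c < size row) && P (nth 0 row c) then Some (nth 0 row c) else None)
    (iota 0 M) = filter P row.
Proof.
move=> rM; rewrite -(subnKC rM) iotaD pmap_cat [pmap _ (iota (0 + _) _)]pmap_none; last first.
  by move=> c; rewrite mem_iota add0n => /andP[h _]; rewrite ltnNge h.
rewrite cats0 -[in RHS](mkseq_nth 0 row) /mkseq.
have : all (fun c => c < size row) (iota 0 (size row)).
  by apply/allP => c; rewrite mem_iota.
by elim: (iota _ _) => //= c s IH /andP[-> /IH->] /=; case: ifP.
Qed.

Lemma fword_restr M : size (nth [::] T 0) <= M ->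
  fword (size T) M (restr T a b) = [seq x <- reading_word T | a <= x <= b].
Proof.
move=> h0; rewrite /fword /reading_word filter_flatten map_rev; congr (flatten (rev _)).
have hM r : size (nth [::] T r) <= M.
  by apply: leq_trans h0; apply: (antimonoP (nu := fun r => size (nth [::] T r)) SYT_row_size).
rewrite -[in RHS](mkseq_nth [::] T) /mkseq -map_comp; apply: eq_map => r /=.
by rewrite -(pmap_nth_filter _ (hM r)).
Qed.

End Restriction.

(** * Standardization and Dyck pattern intervals *)

Lemma count_iota a b n : 0 < a -> a <= b.+1 ->
  count (fun x => a <= x <= b) (iota 1 n) = minn b n - minn a.-1 n.
Proof.
move=> a0 ab; elim: n => [|n IH]; first by rewrite !minn0.
rewrite -{1}(addn1 n) iotaD count_cat IH /= add1n.
by case: (boolP (a <= n.+1 <= b)) => h; lia.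
Qed.

(** Characterizes standardization by its inversions. A letter [y] of a permutation is the number of
    letters at most [y]; left of [y] these sit over letters at most [x] of the first word, right of
    [y] over letters below [x]. *)
Lemma std_wordE zs : pairwise agree zs -> perm_eq (unzip2 zs) (iota 1 (size zs)) ->
  std_word (unzip1 zs) = unzip2 zs.
Proof.
move=> pz pm; apply: (eq_from_nth (x0 := 0)); first by rewrite size_mkseq !size_map.
move=> p; rewrite size_mkseq size_map => pn.
have us : uniq (unzip2 zs) by rewrite (perm_uniq pm) iota_uniq.
rewrite nth_mkseq ?size_map // -map_take !(nth_map (0, 0)) //.
have E : zs = take p zs ++ nth (0, 0) zs p :: drop p.+1 zs.
  by rewrite -drop_nth // cat_take_drop.
have ym : (nth (0, 0) zs p).2 \in unzip2 zs by apply/map_f/mem_nth.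
move: (nth _ _ _) (take p zs) (drop _ _) E ym => [x y] z1 z2 E /= ym.
have -> : y = count (fun u => u <= y) (unzip2 zs).
  have := ym; rewrite (perm_mem pm) mem_iota => hy.
  have /permP -> := pm.
  transitivity (count (fun u => 1 <= u <= y) (iota 1 (size zs))).
    by rewrite count_iota //=; lia.
  by apply: eq_in_count => u; rewrite mem_iota /=; lia.
move: pz us; rewrite E /unzip1 /unzip2 !map_cat /= pairwise_cat /= allrel_consr.
case/and3P=> /andP[a1 _] _ /andP[a2 _].
rewrite cat_uniq /= => /and4P[_ _ yz2 _].
rewrite !count_cat /= ltnn leqnn !count_map.
have -> : count (preim snd (fun u => u <= y)) z1 =
    count (preim fst (fun u => u < x)) z1 + count (preim fst (pred1 x)) z1.
  elim: z1 a1 {E} => //= q z1 IH /andP[aq /IH->].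
  by move: aq; rewrite /agree /=; lia.
have -> : count (preim snd (fun u => u <= y)) z2 = count (preim fst (fun u => u < x)) z2.
  apply: eq_in_count => u uz; have := allP a2 _ uz; rewrite /agree /= => /eqP ->.
  rewrite leq_eqVlt; case: eqP => //= e; case/negP: yz2; rewrite -e; exact: map_f.
by rewrite add0n addnAC add1n addnS.
Qed.

(** The letter at position [p] is one more than the rank of [p] when positions are ordered by
    letter, ties from left to right. *)
Lemma std_exists v : exists zs, [/\ unzip1 zs = v, pairwise agree zs
  & perm_eq (unzip2 zs) (iota 1 (size v))].
Proof.
pose leT p q := (nth 0 v p < nth 0 v q) || (nth 0 v p == nth 0 v q) && (p <= q).
have tot : total leT by move=> p q; rewrite /leT; lia.
have tr : transitive leT by move=> p q r; rewrite /leT; lia.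
have rf : reflexive leT by move=> p; rewrite /leT; lia.
pose l := sort leT (iota 0 (size v)).
have pl : perm_eq l (iota 0 (size v)) by rewrite perm_sort.
have ul : uniq l by rewrite (perm_uniq pl) iota_uniq.
have sl : sorted leT l by apply: sort_sorted.
exists [seq (nth 0 v p, (index p l).+1) | p <- iota 0 (size v)].
rewrite /unzip1 /unzip2 -!map_comp; split.
- by rewrite -[RHS](mkseq_nth 0).
- rewrite pairwise_map; have := iota_ltn_sorted 0 (size v).
  rewrite (sorted_pairwise ltn_trans) => pi.
  apply: (sub_in_pairwise (P := mem l)) pi; last by apply/allP => p; rewrite -(perm_mem pl).
  move=> p q pl' ql' pq; rewrite /= /agree /= ltnS; apply/eqP; apply/idP/idP => h.
    rewrite ltnNge; apply/negP => /(sorted_leq_index tr rf sl p q pl' ql').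
    by rewrite /leT; lia.
  by have := sorted_ltn_index tr sl q p ql' pl' h; rewrite /leT; lia.
- have -> : iota 1 (size v) = map succn (map (index^~ l) l).
    have -> : map (index^~ l) l = iota 0 (size l).
      apply: (eq_from_nth (x0 := 0)); first by rewrite size_map size_iota.
      move=> p; rewrite size_map => pl'.
      by rewrite (nth_map 0) // nth_iota // index_uniq.
    rewrite (perm_size pl) size_iota -[1]/(1 + 0) iotaDl; exact: eq_map.
  by rewrite -map_comp perm_map // perm_sym.
Qed.

(** The scan carries [k] letters [i + 1] still waiting for an [i], while [cphi] and [cf] recurse
    from the right. The pending letters use up [k] of the [cphi i w] unbracketed [i]. *)
Lemma unbrE i w k pos res :
  (cphi i w <= k -> unbr i w k pos res = res) /\
  (k < cphi i w -> exists p, [/\ unbr i w k pos res = Some (pos + p),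
     p < size w & set_nth 0 w p i.+1 = cf i w]).
Proof.
elim: w k pos res => [|x w IH] k pos res /=; first by split.
case: (x =P i.+1) => [ex|nx].
  have -> : (x == i) = false by lia.
  have [H1 H2] := IH k.+1 pos.+1 res; split=> h; first by apply: H1; lia.
  have [|p [-> pw E]] := H2; first by lia.
  exists p.+1; rewrite addnS addSn; split=> //=; rewrite E.
  by have -> : 1 < cphi i w by lia.
case: (x =P i) => [ex|nx'] /=.
  case: k => [|k].
    have [H1 H2] := IH 0 pos.+1 (Some pos); split=> h; first by lia.
    have [h0|h0] := posnP (cphi i w).
      by exists 0; rewrite H1 ?h0 // addn0.
    have [//|p [-> pw E]] := H2.
    by exists p.+1; rewrite addnS addSn; split=> //=; rewrite E.
  have [H1 H2] := IH k pos.+1 res; split=> h; first by apply: H1; lia.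
  have [|p [-> pw E]] := H2; first by lia.
  exists p.+1; rewrite addnS addSn; split=> //=; rewrite E.
  by have -> : 0 < cphi i w by lia.
have [H1 H2] := IH k pos.+1 res; split=> h; first by apply: H1; lia.
have [|p [-> pw E]] := H2; first by lia.
exists p.+1; rewrite addnS addSn; split=> //=; rewrite E.
by have -> : 0 < cphi i w by lia.
Qed.

Lemma crystal_f_wordE i w :
  crystal_f_word i w = if 0 < cphi i w then Some (cf i w) else None.
Proof.
rewrite /crystal_f_word; have [H1 H2] := unbrE i w 0 0 None.
case: ltnP => h; last by rewrite H1.
by have [//|p [-> _ <-]] := H2.
Qed.

Lemma reading_of_word T w : size w = size (reading_word T) -> reading_word (of_word T w) = w.
Proof.
move=> sz; rewrite /reading_word /of_word revK reshapeKr // sz.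
by rewrite size_flatten /shape map_rev.
Qed.

Lemma size_of_word T w : size w = size (reading_word T) -> map size (of_word T w) = map size T.
Proof.
move=> sz; rewrite /of_word map_rev -/(shape _) reshapeKl ?revK //.
by rewrite sz size_flatten /shape map_rev.
Qed.

Lemma of_wordE T U : map size T = map size U -> of_word T (reading_word U) = U.
Proof.
move=> sz; have sw : size (reading_word U) = size (reading_word T).
  by rewrite !size_flatten /shape !map_rev sz.
by apply: reading_word_inj; rewrite ?reading_of_word ?size_of_word.
Qed.

Lemma reading_word_map (h : nat -> nat) T :
  reading_word (map (map h) T) = map h (reading_word T).
Proof. by rewrite /reading_word -map_rev -map_flatten. Qed.

Lemma crystal_fE i T : crystal_f i T =
  if 0 < cphi i (reading_word T) then Some (of_word T (cf i (reading_word T))) else None.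
Proof. by rewrite /crystal_f crystal_f_wordE; case: ifP. Qed.

Definition collapse_letter (i m x : nat) := if i <= x <= i + m then i
  else if i + m < x <= i + 2 * m then i.+1 else x.

Lemma collapse_letter_mono i m x y : x <= y -> collapse_letter i m x <= collapse_letter i m y.
Proof. by rewrite /collapse_letter; do 4?case: ifP; lia. Qed.

Lemma collapse_letter_shift i m k x : collapse_letter (k + i) m (k + x) = k + collapse_letter i m x.
Proof. by rewrite /collapse_letter; do 4?case: ifP; lia. Qed.

Lemma cf_shift i k w : cphi (k + i) (map (addn k) w) = cphi i w /\
  cf (k + i) (map (addn k) w) = map (addn k) (cf i w).
Proof.
elim: w => //= x w [-> ->]; rewrite -addnS !eqn_add2l; split=> //.
by case: ifP => // _; case: ifP => //=.
Qed.

Lemma rsk_P_shift k w : rsk_P (map (addn k) w) = map (map (addn k)) (rsk_P w).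
Proof.
have Hr x r : ins_row (k + x) (map (addn k) r) =
    (omap (addn k) (ins_row x r).1, map (addn k) (ins_row x r).2).
  elim: r => //= y r ->; rewrite ltn_add2l; case: ifP => //= _.
  by case: (ins_row x r).
have Ht x t : rs_ins (k + x) (map (map (addn k)) t) = map (map (addn k)) (rs_ins x t).
  elim: t x => //= r t IH x; rewrite Hr; case: (ins_row x r) => [[y|] r'] //=.
  by rewrite IH.
rewrite /rsk_P -[[::] in LHS]/(map (map (addn k)) [::]).
by elim: w [::] => //= x w IH t; rewrite Ht IH.
Qed.

(** A Knuth move exchanges [x] and [z], and [y] lies between them in value. If both survive the
    filter then so does [y], and the move remains; otherwise the two sides become equal. *)
Lemma knuth_filter a b w w' : knuth w w' ->
  knuth [seq x <- w | a <= x <= b] [seq x <- w' | a <= x <= b].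
Proof.
elim=> [?|u v1 v2 v w1 k _]; first exact: knuth_refl.
apply: knuth_trans; rewrite !filter_cat; apply/knuth_catl/knuth_catr.
have R := knuth_refl; have K c c' : knuth_triple c c' -> knuth c c'.
  by move=> kc; have := knuth_core [::] [::] kc; rewrite !cats0.
by case: k => x y z h1 h2 /=; case: (boolP (a <= x <= b)) => hx;
  case: (boolP (a <= y <= b)) => hy; case: (boolP (a <= z <= b)) => hz;
  try (exact: R); try (by apply: K; constructor); lia.
Qed.

Lemma pairwise_of_filter (A : Type) (r : rel A) (P : pred A) s :
  (forall x y, ~~ (P x && P y) -> r x y) -> pairwise r (filter P s) -> pairwise r s.
Proof.
move=> H; elim: s => //= x s IH; case: ifP => Px /=.
  case/andP=> ax ps; rewrite IH // andbT.
  elim: s ax {IH ps} => //= y s IH; case: ifP => Py /=; first by case/andP=> -> /IH.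
  by rewrite H ?Py ?andbF //= => /IH.
move=> ps; rewrite IH // andbT.
by elim: s {IH ps} => //= y s ->; rewrite H // Px.
Qed.

(** Lets pairs carried along Knuth moves be read again as a word and its image under [h]. *)
Lemma perm_graph (A B : eqType) (h : A -> B) w zs : perm_eq [seq (x, h x) | x <- w] zs ->
  zs = [seq (x, h x) | x <- unzip1 zs].
Proof.
move=> pm; rewrite /unzip1 -map_comp -[LHS]map_id; apply/eq_in_map => p.
by rewrite -(perm_mem pm) => /mapP[x _ ->].
Qed.

(** In the reading word of the two-row tableau the letters that become [i + 1] precede and exceed
    those that become [i], and each group increases, so inversions are kept. Knuth moves transport
    this to the letters of [w] in the interval; pairs not entirely inside it agree in any case. *)
Lemma dyck_agree i m w :
  rsk_P [seq x <- w | i <= x <= i + 2 * m] = [:: iota i m.+1; iota (i + m).+1 m] ->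
  pairwise agree [seq (x, collapse_letter i m x) | x <- w].
Proof.
move=> E; have [k _] := rsk_PP [seq x <- w | i <= x <= i + 2 * m].
rewrite E in k; pose pr x := (x, collapse_letter i m x).
pose d0 := reading_word [:: iota i m.+1; iota (i + m).+1 m].
have Hi s n : pairwise agree (map pr (iota s n)).
  rewrite pairwise_map; have := iota_ltn_sorted s n.
  rewrite (sorted_pairwise ltn_trans); apply: sub_pairwise => x y xy.
  by have := collapse_letter_mono i m (ltnW xy); rewrite /agree /=; lia.
have a0 : pairwise agree (map pr d0).
  have -> : d0 = iota (i + m).+1 m ++ iota i m.+1 by rewrite /d0 !reading_word_cons.
  rewrite map_cat pairwise_cat !Hi !andbT.
  apply/allrelP => _ _ /mapP[x + ->] /mapP[y + ->]; rewrite !mem_iota.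
  by rewrite /pr /agree /collapse_letter /=; do ?case: ifP; lia.
have E0 : unzip1 (map pr d0) = d0 by rewrite /unzip1 -map_comp map_id.
have [zs [E1 pz pm _]] := knuth_agree (knuth_sym k) a0 E0.
have Ez := perm_graph pm; rewrite E1 in Ez.
rewrite pairwise_map; apply: (pairwise_of_filter (P := fun x => i <= x <= i + 2 * m)).
  by move=> x y /=; rewrite /agree /collapse_letter /=; do ?case: ifP; lia.
by rewrite -(pairwise_map pr) -Ez.
Qed.

(** The edge operator collapses, applies [cf] and standardizes. When [zs1] records the last step for
    the word [w1], [zs] is the parallel step for the equivalent word [w], and [unzip2 zs] is the
    word that the edge reaches from [w]. *)
Lemma edge_word i m w w1 zs1 : knuth w w1 ->
  pairwise agree [seq (x, collapse_letter i m x) | x <- w1] ->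
  unzip1 zs1 = cf i (map (collapse_letter i m) w1) -> pairwise agree zs1 ->
  exists zs, [/\ unzip1 zs = cf i (map (collapse_letter i m) w), pairwise agree zs,
    knuth (unzip2 zs) (unzip2 zs1), suffix_eq w (unzip2 zs)
    & cphi i (map (collapse_letter i m) w) = cphi i (map (collapse_letter i m) w1)].
Proof.
move=> k a1 E1 p1; pose pr x := (x, collapse_letter i m x).
have U1 : unzip1 (map pr w1) = w1 by rewrite /unzip1 -map_comp map_id.
have [zw [Ew pw pm kw]] := knuth_agree (knuth_sym k) a1 U1.
have Ez := perm_graph pm; rewrite Ew in Ez.
have U2 v : unzip2 (map pr v) = map (collapse_letter i m) v by rewrite /unzip2 -map_comp.
rewrite Ez !U2 in kw; have [ph _ kf _] := knuth_crystal i kw.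
have [zs [E pz _ kz]] := knuth_agree kf p1 E1.
exists zs; split=> //; first exact: knuth_sym.
apply: suffix_eq_trans (suffix_eq_agree pz); rewrite E.
apply: suffix_eq_trans (suffix_eq_cf i _).
by have := suffix_eq_agree pw; rewrite Ew Ez U2.
Qed.

(** * Replacing the middle of a tableau *)

(* Intended for [size u = count P W]; a shorter [u] is padded through [h]. *)
Fixpoint fill (A : Type) (h : nat -> A) (P : pred nat) (W : seq nat) (u : seq A) : seq A :=
  if W is x :: W' then
    if P x then (if u is y :: u' then y :: fill h P W' u' else h x :: fill h P W' [::])
    else h x :: fill h P W' u
  else [::].

Lemma map_fill (A B : Type) (f : A -> B) h P W u :
  map f (fill h P W u) = fill (f \o h) P W (map f u).
Proof.
elim: W u => //= x W IH u; case: ifP => _ /=; last by rewrite IH.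
by case: u => [|y u] /=; rewrite IH.
Qed.

Lemma size_fill (A : Type) (h : nat -> A) P W u : size (fill h P W u) = size W.
Proof. by elim: W u => //= x W IH u; case: ifP => _; [case: u|] => *; rewrite /= IH. Qed.

Lemma fill_cat (A : Type) (h : nat -> A) P W1 W2 u1 u2 : size u1 = count P W1 ->
  fill h P (W1 ++ W2) (u1 ++ u2) = fill h P W1 u1 ++ fill h P W2 u2.
Proof.
elim: W1 u1 => [|x W IH] u1 /=; first by case: u1.
by case: ifP => _; [case: u1 => //= y u1 [/IH->]|move=> /IH->].
Qed.

Lemma eq_fill (A : Type) (h h' : nat -> A) P W u : size u = count P W ->
  (forall x, ~~ P x -> h x = h' x) -> fill h P W u = fill h' P W u.
Proof.
move=> sz H; elim: W u sz => //= x W IH u; case: ifP => Px.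
  by case: u => //= y u [/IH->].
by rewrite add0n => /IH->; rewrite H ?Px.
Qed.

Lemma all_fill (A : Type) (Q : pred A) h P W u : size u = count P W ->
  all Q u -> (forall x, ~~ P x -> Q (h x)) -> all Q (fill h P W u).
Proof.
move=> sz au H; elim: W u sz au => //= x W IH u; case: ifP => Px.
  by case: u => //= y u [/IH h1] /andP[-> /h1].
by rewrite add0n => /IH h1 /h1 /= ->; rewrite H ?Px.
Qed.

Lemma filter_fill P W u : size u = count P W -> all P u -> filter P (fill id P W u) = u.
Proof.
elim: W u => [|x W IH] u /=; first by case: u.
case: ifP => Px; first by case: u => //= y u [/IH h] /andP[-> /h->].
by rewrite add0n /= Px; apply: IH.
Qed.

Lemma perm_fill P W u : perm_eq u (filter P W) -> perm_eq (fill id P W u) W.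
Proof.
move=> pu; have sz : size u = count P W by rewrite (perm_size pu) size_filter.
apply: (@perm_trans _ (u ++ filter (predC P) W)).
  elim: W u sz {pu} => [|x W IH] u /=; first by case: u.
  case: ifP => Px /=; first by case: u => //= y u [/IH]; rewrite perm_cons.
  rewrite add0n => /IH h; rewrite -(perm_cons x) in h; apply: perm_trans h _.
  by rewrite perm_sym perm_catC /= perm_cons perm_catC.
by rewrite perm_sym -(perm_filterC P W) perm_cat2r perm_sym.
Qed.

(** Letters outside [P] differ from [i] and [i + 1] and take no part in the bracketing. *)
Lemma cf_fill i (P : pred nat) W v : P i -> P i.+1 -> size v = count P W ->
  cphi i (fill id P W v) = cphi i v /\ cf i (fill id P W v) = fill id P W (cf i v).
Proof.
move=> P0 P1; elim: W v => [|x W IH] v /=; first by case: v.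
case: ifP => Px; first case: v => //= y v [sz].
  have [-> ->] := IH _ sz; split=> //.
  by case: ifP => //= _.
rewrite add0n => sz; have [E1 E2] := IH _ sz; rewrite /= E1 E2.
have -> : (x == i) = false by apply: contraFF Px => /eqP->.
have -> : (x == i.+1) = false by apply: contraFF Px => /eqP->.
rewrite subn0; split=> //; case: ltnP => // h.
by rewrite cf_phi0 //; lia.
Qed.

(** An outside letter, paired with itself, compares alike with both members of a pair inside because
    [P] is an interval. *)
Lemma agree_fill a b W zs : let P x := a <= x <= b in
  size zs = count P W -> all P (unzip1 zs) -> all P (unzip2 zs) ->
  pairwise agree zs -> pairwise agree (fill (fun x => (x, x)) P W zs).
Proof.
move=> P; elim: W zs => //= x W IH zs; case: ifP => Px.
  case: zs => //= z zs [sz] /andP[z1 a1] /andP[z2 a2] /andP[az pz].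
  rewrite IH // andbT; apply: all_fill => // y.
  by move: z1 z2; rewrite /agree /P /=; lia.
rewrite add0n => sz a1 a2 pz /=; rewrite IH // andbT; apply: all_fill => //.
  apply/allP => z zz; have := allP a1 _ (map_f fst zz); have := allP a2 _ (map_f snd zz).
  by move: Px; rewrite /agree /P /=; lia.
by move=> y _; rewrite /agree /= eqxx.
Qed.

Lemma sstP ss t : sst ss t <-> forall r, r < size t ->
  [/\ sorted leq (nth [::] t r), rowdom (nth 0 ss r) (nth [::] t r.+1) (nth [::] t r)
    & size (nth [::] t r.+1) <= nth 0 ss r + size (nth [::] t r)].
Proof.
elim: t ss => [|Y t IH] ss //=.
split=> [/and4P[sY dY zY /IH st] [|r] /= rt|H].
- by rewrite !nth0; split.
- by have := st r rt; rewrite nth_behead.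
have [/= a1 a2 a3] := H 0 isT; rewrite !nth0 in a2 a3; rewrite a1 a2 a3.
by apply/IH => r rt; have := H r.+1 rt; rewrite nth_behead.
Qed.

Lemma SYT_straight lam S : is_SYT lam S -> straight S.
Proof.
move=> syt; have [/andP[_ pos] E _ hc _] := syt; rewrite /straight E pos andbT.
apply/sstP => r rS; rewrite nth_nil; split.
- by have := SYT_row_sorted syt r; rewrite ltn_sorted_uniq_leq => /andP[].
- by apply/rowdomP => j jY jX; apply: hc.
- exact: SYT_row_size syt r.
Qed.

Lemma straight_SYT lam S : is_part lam -> map size S = lam -> sst [::] S ->
  perm_eq (reading_word S) (iota 1 (sumn lam)) -> is_SYT lam S.
Proof.
move=> pl E /sstP st pm.
have pm' : perm_eq (flatten S) (reading_word S).
  by apply: perm_flatten; rewrite perm_sym perm_rev.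
have us : uniq (flatten S) by rewrite (perm_uniq pm') (perm_uniq pm) iota_uniq.
split=> //; last exact: perm_trans pm' pm.
- apply/(all_nthP [::]) => r rS; have [sr _ _] := st r rS.
  rewrite ltn_sorted_uniq_leq sr andbT; move: us.
  rewrite -{1}(cat_take_drop r S) (drop_nth [::] rS) flatten_cat /= !cat_uniq.
  by case/and3P=> _ _ /and3P[].
- move=> r c cr; have rS : r < size S.
    by rewrite ltnNge; apply/negP => h; rewrite nth_default // ltnW in cr.
  have [_ /rowdomP d z] := st r rS; rewrite nth_nil in d z.
  by apply: d => //; exact: leq_trans z.
Qed.

Section Glue.

Variables (lam : seq nat) (T : tableau) (a b : nat).
Hypotheses (sytT : is_SYT lam T) (ab : a <= b).

Let P x := a <= x <= b.
Let low r := count (fun x => x < a) (nth [::] T r).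
Let upp r := count (fun x => x < b.+1) (nth [::] T r).
(** Row [r] of the middle part starts in column [low r], so these are the shifts expected by
    [sst]. *)
Let ss := mkseq (fun r => low r - low r.+1) (size T).
Let w0 := filter P (reading_word T).

Definition glue (t : tableau) : tableau := [seq fill id P x.1 x.2 | x <- zip T t].

Lemma count_mid r : count P (nth [::] T r) = upp r - low r.
Proof.
rewrite /upp /low; elim: (nth _ _ _) => //= x s IH.
have h : count (fun x => x < a) s <= count (fun x => x < b.+1) s.
  by apply: sub_count => y /=; lia.
by rewrite IH /P; lia.
Qed.

Lemma low_upp r : low r <= upp r.
Proof. by apply: sub_count => y /=; lia. Qed.

Lemma nth_fill row u c : sorted ltn row -> size u = count P row -> c < size row ->
  nth 0 (fill id P row u) c =
    if count (fun x => x < a) row <= c < count (fun x => x < b.+1) row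
    then nth 0 u (c - count (fun x => x < a) row) else nth 0 row c.
Proof.
elim: row u c => //= x row IH u c px; have sr := path_sorted px.
have gx := allP (order_path_min ltn_trans px).
case: (boolP (P x)) => Px.
  have -> : count (fun x => x < a) row = 0.
    apply/eqP; rewrite -leqn0 leqNgt -has_count; apply/hasPn => y /gx.
    by move: Px; rewrite /P /=; lia.
  have -> : (x < a) = false by move: Px; rewrite /P; lia.
  have -> : x < b.+1 by move: Px; rewrite /P; lia.
  case: u => //= y u [sz]; case: c => [|c] //= cr.
  rewrite (IH u c) // [count (fun x => x < a) row](_ : _ = 0) ?subn0 //.
  apply/eqP; rewrite -leqn0 leqNgt -has_count; apply/hasPn => z /gx.
  by move: Px; rewrite /P /=; lia.
rewrite add0n => sz; case: (ltnP x a) => xa.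
  have -> : x < b.+1 by lia.
  by case: c => [|c] //= cr; rewrite (IH u c).
have zb : count (fun x => x < b.+1) row = 0.
  apply/eqP; rewrite -leqn0 leqNgt -has_count; apply/hasPn => y /gx.
  by move: Px; rewrite /P /=; lia.
have -> : x < b.+1 = false by move: Px; rewrite /P; lia.
rewrite zb ltn0 andbF; case: c => [|c] //= cr.
by rewrite (IH u c) // zb ltn0 andbF.
Qed.

Lemma rows_eq (t : tableau) : map size t = map (count P) T -> size t = size T /\
  forall r, size (nth [::] t r) = count P (nth [::] T r).
Proof.
move=> E; have sz : size t = size T by rewrite -(size_map size) E size_map.
split=> // r; have [h|h] := ltnP r (size T).
  by rewrite -(nth_map _ 0) ?sz // E (nth_map [::]).
by rewrite !nth_default ?sz.
Qed.

Lemma reading_glue t : map size t = map (count P) T ->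
  reading_word (glue t) = fill id P (reading_word T) (reading_word t) /\
  size (reading_word t) = count P (reading_word T).
Proof.
rewrite /glue; elim: (T) t => [|row T' IH] [|u t] //= [sz E].
have [IH1 IH2] := IH _ E; rewrite !reading_word_cons IH1 fill_cat //; split=> //.
by rewrite size_cat count_cat IH2 sz.
Qed.

Lemma size_glue t : map size t = map (count P) T -> map size (glue t) = map size T.
Proof.
move=> /rows_eq[sz _]; rewrite /glue -map_comp.
rewrite (eq_map (g := size \o fst)); last by move=> x /=; rewrite size_fill.
by rewrite map_comp -/(unzip1 _) unzip1_zip ?sz.
Qed.

Lemma nth_glue t r : map size t = map (count P) T ->
  nth [::] (glue t) r = fill id P (nth [::] T r) (nth [::] t r).
Proof.
move=> /rows_eq[sz _]; have [h|h] := ltnP r (size T).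
  by rewrite (nth_map ([::], [::])) ?size_zip ?sz ?minnn // nth_zip.
by rewrite !nth_default ?size_map ?size_zip ?sz ?minnn.
Qed.

Lemma sst_mid : sst ss (map (filter P) T) /\ map size (map (filter P) T) = map (count P) T /\
  reading_word (map (filter P) T) = w0.
Proof.
have F r : nth [::] (map (filter P) T) r = filter P (nth [::] T r).
  have [h|h] := ltnP r (size T); first by rewrite (nth_map [::]).
  by rewrite !nth_default ?size_map.
have E : map size (map (filter P) T) = map (count P) T.
  by rewrite -map_comp; apply: eq_map => r /=; rewrite size_filter.
split; last first.
  by split=> //; rewrite /w0 /reading_word filter_flatten map_rev.
have nthF r j : j < size (filter P (nth [::] T r)) ->
    nth 0 (filter P (nth [::] T r)) j = nth 0 (nth [::] T r) (low r + j) /\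
    low r + j < size (nth [::] T r).
  rewrite size_filter count_mid => hj.
  have us : upp r <= size (nth [::] T r) by apply: count_size.
  split; last by lia.
  have sr := SYT_row_sorted sytT r.
  (* Refilling the row with its own entries in [P] restores it, so [nth_fill] locates these
     entries. *)
  have := nth_fill (c := low r + j) sr (u := filter P (nth [::] T r)).
  rewrite size_filter => /(_ erefl); have -> : low r + j < size (nth [::] T r) by lia.
  move/(_ isT); rewrite -/(low r) -/(upp r).
  have -> : low r <= low r + j < upp r by lia.
  rewrite addKn => <-; congr (nth _ _ _).
  by elim: (nth [::] T r) => //= x s IH; case: (boolP (P x)) => Px; rewrite ?IH.
apply/sstP => r; rewrite size_map => rT; rewrite !F.
have la := SYT_count_antimono sytT a r; have lb := SYT_count_antimono sytT b.+1 r.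
have Es : nth 0 ss r = low r - low r.+1 by rewrite nth_mkseq.
split.
- apply: sorted_filter; first exact: leq_trans.
  by have := SYT_row_sorted sytT r; rewrite ltn_sorted_uniq_leq => /andP[].
- apply/rowdomP => j jY; rewrite Es => jX.
  have [-> h1] := nthF _ _ jY; have [-> h2] := nthF _ _ jX.
  have Ec : low r.+1 + (low r - low r.+1 + j) = low r + j by rewrite /low; lia.
  by rewrite Ec in h2 *; apply: (SYT_col sytT).
- by rewrite !size_filter !count_mid Es; have := low_upp r; rewrite /low /upp; lia.
Qed.

(** New entries stay in [[a,b]] and occupy the same cells, so comparisons with old entries come out
    as in [T], and comparisons among new ones are those of [t]. Weak increase along rows suffices,
    as the letters are distinct. *)
Lemma glue_SYT t : sst ss t -> map size t = map (count P) T ->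
  perm_eq (reading_word t) w0 -> is_SYT lam (glue t).
Proof.
move=> st E pm; have [pl ES _ _ pT] := sytT; have [sz szr] := rows_eq E.
have [Er Sr] := reading_glue E.
have pmT : perm_eq (reading_word (glue t)) (reading_word T).
  by rewrite Er; apply: perm_fill.
have mem r j : j < size (nth [::] t r) -> a <= nth 0 (nth [::] t r) j <= b.
  move=> h; suff : nth 0 (nth [::] t r) j \in w0 by rewrite mem_filter => /andP[].
  rewrite -(perm_mem pm); apply/flattenP; exists (nth [::] t r); last exact: mem_nth.
  rewrite mem_rev mem_nth // ltnNge; apply/negP => hr.
  by rewrite (nth_default _ hr) in h.
have us : uniq (reading_word t).
  rewrite (perm_uniq pm) filter_uniq //.
  have pm1 : perm_eq (flatten T) (reading_word T).
    by apply: perm_flatten; rewrite perm_sym perm_rev.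
  by rewrite -(perm_uniq pm1) (perm_uniq pT) iota_uniq.
have st' r : [/\ sorted leq (nth [::] t r), rowdom (low r - low r.+1) (nth [::] t r.+1) (nth [::] t r)
    & size (nth [::] t r.+1) <= low r - low r.+1 + size (nth [::] t r)].
  have [h|h] := ltnP r (size t); last by rewrite !nth_default // ltnW.
  by have := (sstP _ _).1 st r h; rewrite nth_mkseq -?sz.
have val r c : c < size (nth [::] T r) -> nth 0 (nth [::] (glue t) r) c =
    if low r <= c < upp r then nth 0 (nth [::] t r) (c - low r) else nth 0 (nth [::] T r) c.
  by move=> cr; rewrite nth_glue // nth_fill ?szr // ?SYT_row_sorted //; exact: SYT_row_sorted sytT r.
have cl r c := @sorted_count_lt _ a c (SYT_row_sorted sytT r).
have cu r c := @sorted_count_lt _ b.+1 c (SYT_row_sorted sytT r).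
have srow r : size (nth [::] (glue t) r) = size (nth [::] T r).
  by rewrite nth_glue // size_fill.
have memc r c : low r <= c < upp r -> a <= nth 0 (nth [::] t r) (c - low r) <= b.
  by move=> h; apply: mem; rewrite szr count_mid; lia.
apply: straight_SYT => //; first by rewrite size_glue.
  apply/sstP => r rS; rewrite nth_nil; split.
  - case Es: (nth [::] (glue t) r) => [//|x s]; rewrite -Es {Es x s}.
    apply/(sortedP 0) => c; rewrite srow => cr; have cr' := ltnW cr.
    rewrite !val //; have := cl r c cr'; have := cl r _ cr; have := cu r c cr'.
    have := cu r _ cr; rewrite -/(low r) -/(upp r) => e1 e2 e3 e4.
    have lt : nth 0 (nth [::] T r) c < nth 0 (nth [::] T r) c.+1.
      by apply: (sortedP 0 (SYT_row_sorted sytT r)).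
    have [sr _ _] := st' r.
    case: ifP => h1; case: ifP => h2.
    + by apply: sorted_nth_leq => //; rewrite ?szr ?count_mid; lia.
    + by have := memc _ _ h1; lia.
    + by have := memc _ _ h2; lia.
    + by lia.
  - apply/rowdomP => c; rewrite !srow add0n => cr cr1.
    rewrite !val //; have := cl r c cr; have := cl _ _ cr1; have := cu r c cr.
    have := cu _ _ cr1; rewrite -/(low r) -/(upp r) -/(low r.+1) -/(upp r.+1) => e1 e2 e3 e4.
    have lt : nth 0 (nth [::] T r) c < nth 0 (nth [::] T r.+1) c by apply: (SYT_col sytT).
    have la := SYT_count_antimono sytT a r; have lb := SYT_count_antimono sytT b.+1 r.
    rewrite -/(low r) -/(low r.+1) in la; rewrite -/(upp r) -/(upp r.+1) in lb.
    have [_ /rowdomP dm _] := st' r.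
    case: ifP => h1; case: ifP => h2.
    + have := dm (c - low r); rewrite !szr !count_mid.
      have -> : low r - low r.+1 + (c - low r) = c - low r.+1 by lia.
      by apply; lia.
    + by have := memc _ _ h1; lia.
    + by have := memc _ _ h2; lia.
    + by lia.
  - by rewrite !srow; apply: SYT_row_size sytT r.
apply: perm_trans pmT _; apply: perm_trans pT.
by rewrite perm_sym; apply: perm_flatten; rewrite perm_sym perm_rev.
Qed.

End Glue.

(** * Edges of crystal skeletons and the embedding *)

Lemma perm_reading_word T : perm_eq (reading_word T) (flatten T).
Proof. by apply: perm_flatten; rewrite perm_rev. Qed.

(** Collapsing, [cf] and standardization each preserve shape and semistandardness, so the target is
    again a standard tableau. The list [zs] pairs the word before standardization with the word of
    [S']. *)
Lemma CS_edge_target mu S i m S' : CS_edge mu S i m S' ->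
  let w := reading_word S in
  [/\ is_SYT mu S', pairwise agree [seq (x, collapse_letter i m x) | x <- w],
      0 < cphi i (map (collapse_letter i m) w) &
      exists zs, [/\ unzip1 zs = cf i (map (collapse_letter i m) w), unzip2 zs = reading_word S'
        & pairwise agree zs]].
Proof.
case=> sS /and4P[m0 i0 iN /eqP dS] [b' []].
rewrite crystal_fE reading_word_map -/(collapse_letter i m); set w := reading_word S => /= .
case: ltnP => // ph [<-] ->; have da := dyck_agree dS.
have [pl ES _ _ pS] := sS; have /andP[st _] := SYT_straight sS.
set v := cf i _; have szv : size v = size w by rewrite size_cf size_map.
have szb : map size (dyck_collapse i m S) = mu.
  by rewrite -map_comp -ES; apply: eq_map => r /=; rewrite size_map.
have [zs [E1 pz pm]] := std_exists v.
have szz : size zs = size v by rewrite -E1 size_map.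
have Es : std_word v = unzip2 zs by rewrite -E1; apply: std_wordE => //; rewrite szz.
have szw : size w = sumn mu by rewrite /w size_flatten /shape map_rev sumn_rev ES.
have sc : size v = size (reading_word (dyck_collapse i m S)).
  by rewrite reading_word_map size_map szv.
have E1c : unzip1 [seq (x, collapse_letter i m x) | x <- w] = w by rewrite /unzip1 -map_comp map_id.
have [tc [Sc Ec stc]] := sst_agree st E1c da.
have {}Ec : reading_word tc = map (collapse_letter i m) w by rewrite Ec /unzip2 -map_comp.
have [tv [Ev Sv stv _]] := cf_sst i stc; rewrite Ec -/v in Ev.
have [ts [Ss Ets sts]] := sst_agree stv (etrans E1 (esym Ev)) pz.
have -> : std (of_word (dyck_collapse i m S) v) = ts.
  rewrite /std reading_of_word // Es -Ets; apply: of_wordE.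
  by rewrite size_of_word // szb Ss Sv Sc ES.
split=> //; last by exists zs.
by apply: straight_SYT; rewrite ?Ss ?Sv ?Sc // Ets -szw -szv.
Qed.

Lemma shift_straight k t : straight t -> straight (map (map (addn k)) t).
Proof.
case/andP=> st pos; rewrite /straight -map_comp.
rewrite (eq_map (g := size)) ?pos ?andbT; last by move=> r /=; rewrite size_map.
have E : unzip1 [seq (x, k + x) | x <- reading_word t] = reading_word t.
  by rewrite /unzip1 -map_comp map_id.
have p : pairwise agree [seq (x, k + x) | x <- reading_word t].
  rewrite pairwise_map; elim: (reading_word t) => //= x s ->; rewrite andbT.
  by apply/allP => y _; rewrite /= /agree /= ltn_add2l.
have [t' [S E' st']] := sst_agree st E p.
suff -> : map (map (addn k)) t = t' by [].
apply: reading_word_inj; first by rewrite reading_word_map E' /unzip2 -map_comp.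
by rewrite S -map_comp; apply: eq_map => r /=; rewrite size_map.
Qed.

Lemma count_reading_word_interval (lam : seq nat) T a b : is_SYT lam T -> 0 < a -> a <= b ->
  b <= sumn lam -> count (fun x => a <= x <= b) (reading_word T) = b - a.-1.
Proof.
move=> [_ _ _ _ pT] a0 ab bN.
have /permP -> := perm_trans (perm_reading_word T) pT.
by rewrite count_iota //; lia.
Qed.

Theorem theorem4p7 (lam : seq nat) (T : tableau) (a b : nat)
    (g : filling) (mu : seq nat) :
  is_SYT lam T ->
  1 <= a -> a <= b -> b <= sumn lam ->
  rectifies (restr_inner T a) (restr T a b) g ->
  shape_of g mu ->
  exists phi : tableau -> tableau,
    [/\ (forall S, is_SYT mu S -> is_SYT lam (phi S)),
        (forall S S', is_SYT mu S -> is_SYT mu S' -> phi S = phi S' -> S = S') &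
        (forall S S' i m, CS_edge mu S i m S' ->
           CS_edge lam (phi S) (i + a - 1) m (phi S'))].
Proof.
move=> sytT a0 ab bN rec shp; set P := fun x => a <= x <= b.
(* Adding [k] moves the letters of a standard tableau of shape [mu] onto [a..b]. *)
pose w0 := filter P (reading_word T); pose k := a.-1.
pose sh0 := map (count P) T.
pose low r := count (fun x => x < a) (nth [::] T r).
pose ss := mkseq (fun r => low r - low r.+1) (size T).
have [_ _ _ _ pT] := sytT.
(* The rectification serves only to obtain the shape of the tableau equivalent to [w0]. *)
have [t0 [st0 S0 k0]] : exists t0, [/\ straight t0, map size t0 = mu & knuth w0 (reading_word t0)].
  have sk := restr_skew sytT ab.
  set M := size (nth [::] T 0).
  have lM : count (fun x => x < b.+1) (nth [::] T 0) <= M by apply: count_size.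
  have lL s : size T <= s -> count (fun x => x < b.+1) (nth [::] T s) = 0.
    by move=> h; rewrite nth_default.
  have [la [m1 l1 sk1 k1]] := rectifiesP lM lL rec sk.
  have [t [st S E]] := fword_straight m1 l1 sk1 shp.
  by exists t; split=> //; rewrite E /w0 -(fword_restr a b sytT (leqnn _)).
have smu : sumn mu = b - k.
  rewrite -S0 -(count_reading_word_interval sytT a0 ab bN) -/P -size_filter -/w0.
  by rewrite (perm_size (knuth_perm k0)) size_flatten /shape map_rev sumn_rev.
pose sw S := map (addn k) (reading_word S).
pose good S U := exists t, [/\ sst ss t, map size t = sh0, knuth (reading_word t) (sw S),
  suffix_eq w0 (reading_word t) & U = glue T a b t].
(* The implication stands inside the existential so that choice yields a total function, with
   arbitrary values on other tableaux. *)
have ex S : exists U, is_SYT mu S -> good S U.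
  case: (excluded_middle_informative (is_SYT mu S)) => [sS|nS]; last by exists [::].
  have sS' := shift_straight k (SYT_straight sS); have [_ ES _ _ _] := sS.
  have E : map size t0 = map size (map (map (addn k)) S).
    by rewrite S0 -ES -map_comp; apply: eq_map => r /=; rewrite size_map.
  have [w kw rw] := knuth_suffix_eq_exists st0 sS' E k0.
  have [stT [ST ET]] := sst_mid sytT ab.
  have sk0 : skew_word ss sh0 w0 by exists (map (filter P) T).
  have [t [st S1 Et]] := skew_word_suffix_eq sk0 rw.
  exists (glue T a b t) => _; exists t; split=> //; rewrite Et //.
  by rewrite /sw -reading_word_map.
have [phi Hphi] := choice _ ex.
have pmS S t : is_SYT mu S -> knuth (reading_word t) (sw S) -> suffix_eq w0 (reading_word t) ->
    all P (reading_word t) /\ perm_eq (reading_word t) w0.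
  move=> [_ ES _ _ pS] kt rt.
  have pmt : perm_eq (reading_word t) (iota a (b - k)).
    apply: perm_trans (knuth_perm kt) _; rewrite /sw.
    have -> : iota a (b - k) = map (addn k) (iota 1 (b - k)).
      by rewrite -iotaDl addn1 prednK.
    by apply: perm_map; rewrite -smu; apply: perm_trans (perm_reading_word S) pS.
  split; first by rewrite (perm_all _ pmt); apply/allP => x; rewrite mem_iota /P; lia.
  apply: perm_trans pmt _; apply: uniq_perm; first exact: iota_uniq.
    by rewrite filter_uniq // (perm_uniq (perm_trans (perm_reading_word T) pT)) iota_uniq.
  move=> x; rewrite mem_iota mem_filter.
  by rewrite (perm_mem (perm_trans (perm_reading_word T) pT)) mem_iota /P; lia.
have phiSYT S : is_SYT mu S -> is_SYT lam (phi S).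
  move=> sS; have [t [st St kt rt ->]] := Hphi S sS.
  by apply: glue_SYT => //; have [] := pmS S t sS kt rt.
exists phi; split=> //.
  (* Filtering recovers the word of [t] from [phi S], hence the Knuth class of the shifted [S],
     which contains only one straight tableau. *)
  move=> S S' sS sS'; have [t [st St kt rt ->]] := Hphi S sS.
  have [t' [st' St' kt' rt' ->]] := Hphi S' sS' => E.
  have [R1 z1] := reading_glue St; have [R2 z2] := reading_glue St'.
  have Ert : reading_word t = reading_word t'.
    rewrite -(filter_fill z1 (pmS S t sS kt rt).1) -R1 E R2.
    by rewrite (filter_fill z2 (pmS S' t' sS' kt' rt').1).
  have kk : knuth (sw S) (sw S') by apply: knuth_trans (knuth_sym kt) _; rewrite Ert.
  rewrite /sw -!reading_word_map in kk.
  have := knuth_straight_inj (shift_straight k (SYT_straight sS)) (shift_straight k (SYT_straight sS')) kk.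
  by apply: inj_map; apply: inj_map; exact: addnI.
move=> S S' i m edge; have [sS' da ph [zs [E1 E2 pz]]] := CS_edge_target edge.
have [sS /and4P[m0 i0 iN /eqP dS] _] := edge.
have -> : i + a - 1 = k + i by rewrite /k; lia.
have [t [st St kt rt ES]] := Hphi S sS; have [t' [st' St' kt' rt' ES']] := Hphi S' sS'.
have [pt pmt] := pmS S t sS kt rt; have [pt' pmt'] := pmS S' t' sS' kt' rt'.
have [R1 z1] := reading_glue St; have [R2 z2] := reading_glue St'.
set j := k + i.
have colE : map (collapse_letter j m) (sw S) = map (addn k) (map (collapse_letter i m) (reading_word S)).
  by rewrite /sw -!map_comp; apply: eq_map => x /=; rewrite collapse_letter_shift.
have da' : pairwise agree [seq (x, collapse_letter j m x) | x <- sw S].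
  move: da; rewrite /sw -map_comp !pairwise_map; apply: sub_pairwise => x y.
  by rewrite /agree /= !collapse_letter_shift !ltn_add2l.
pose zs1 := [seq (k + p.1, k + p.2) | p <- zs].
have U1 : unzip1 zs1 = cf j (map (collapse_letter j m) (sw S)).
  by rewrite colE (cf_shift i k _).2 -E1 /unzip1 -!map_comp.
have U2 : unzip2 zs1 = sw S' by rewrite /sw -E2 /unzip2 -!map_comp.
have pz1 : pairwise agree zs1.
  by move: pz; rewrite pairwise_map; apply: sub_pairwise => x y; rewrite /agree /= !ltn_add2l.
have [zs2 [V1 pz2 kz rz phE]] := edge_word kt da' U1 pz1.
(* Both words lie in the Knuth class of the shifted [S'] and in the suffix class of [w0]. *)
have Vt : unzip2 zs2 = reading_word t'.
  apply: knuth_suffix_eq_eq; first by apply: knuth_trans kz _; rewrite U2; apply: knuth_sym.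
  by apply: suffix_eq_trans (suffix_eq_sym rz) (suffix_eq_trans (suffix_eq_sym rt) rt').
have ph' : 0 < cphi j (map (collapse_letter j m) (reading_word t)).
  by rewrite phE colE (cf_shift i k _).1.
(* The shifted interval ends by [b] because [mu] has [b - a + 1] cells. *)
have [aj jb] : a <= j /\ j + 2 * m <= b.
  by move: a0 i0 ab iN; rewrite smu /j /k; clear; lia.
have colP x : ~~ P x -> collapse_letter j m x = x.
  by move: aj jb; rewrite /P /collapse_letter; clear; do ?case: ifP; lia.
have szc : size (map (collapse_letter j m) (reading_word t)) = count P (reading_word T) by rewrite size_map.
have Ec : map (collapse_letter j m) (reading_word (phi S)) =
    fill id P (reading_word T) (map (collapse_letter j m) (reading_word t)).
  by rewrite ES R1 map_fill; apply: eq_fill.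
have Pj : P j by move: aj jb m0; rewrite /P; clear; lia.
have Pj1 : P j.+1 by move: aj jb m0; rewrite /P; clear; lia.
have [F1 F2] := cf_fill Pj Pj1 szc.
split.
- exact: phiSYT.
- apply/and4P; split=> //; last apply/eqP.
  + by rewrite /j addn_gt0 i0 orbT.
  + exact: leq_trans jb bN.
  have -> : [seq x <- reading_word (phi S) | j <= x <= j + 2 * m] =
      [seq x <- reading_word t | j <= x <= j + 2 * m].
    rewrite -(filter_fill z1 pt) -R1 -ES -filter_predI; apply: eq_filter => x /=.
    by move: aj jb; rewrite /P; clear; lia.
  (* Filtering respects Knuth equivalence, so the insertion tableau on the interval is that of [S],
     shifted by [k]. *)
  rewrite (rsk_P_knuth (knuth_filter _ _ kt)) /sw filter_map.
  rewrite (eq_filter (a2 := fun x => i <= x <= i + 2 * m)); last first.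
    by move=> x /=; rewrite /j -addnA !leq_add2l.
  by rewrite rsk_P_shift dS /= -!iotaDl /j !addnS addnA.
pose c := dyck_collapse j m (phi S).
have rc : reading_word c = fill id P (reading_word T) (map (collapse_letter j m) (reading_word t)).
  by rewrite /c reading_word_map -/(collapse_letter j m) Ec.
exists (of_word c (cf j (reading_word c))); split.
  by rewrite crystal_fE -/c rc F1 ph'.
have szz : size (cf j (reading_word c)) = size (reading_word c) by rewrite size_cf.
rewrite /std reading_of_word // rc F2.
have [_ ELS _ _ _] := phiSYT S sS; have [_ ELS' _ _ pLS'] := phiSYT S' sS'.
(* Outside [[a,b]] letters are paired with themselves; [zW] thus pairs the whole word before
   standardization with the word of [phi S']. *)
pose zW := fill (fun x => (x, x)) P (reading_word T) zs2.
have W1 : unzip1 zW = fill id P (reading_word T) (cf j (map (collapse_letter j m) (reading_word t))).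
  by rewrite /unzip1 map_fill -/(unzip1 _) V1.
have W2 : unzip2 zW = reading_word (phi S').
  by rewrite /unzip2 map_fill -/(unzip2 _) Vt ES' R2.
have pW : pairwise agree zW.
  apply: agree_fill => //.
  - by rewrite -[LHS](size_map fst) -/(unzip1 _) V1 size_cf size_map.
  - rewrite V1; apply/allP => x.
    have : all P (map (collapse_letter j m) (reading_word t)).
      apply/allP => _ /mapP[y yt ->]; have := allP pt _ yt.
      by move: aj jb m0; rewrite /P /collapse_letter; clear; do ?case: ifP; lia.
    (* The only letter that [cf] can introduce is [j + 1], which satisfies [P]. *)
    elim: (map _ _) x => //= y s IH x /andP[Py Ps]; case: ifP => _; rewrite inE => /orP[/eqP->|].
    + by [].
    + exact: IH.
    + by case: ifP.
    + by apply: (allP Ps).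
  - by rewrite Vt.
have -> : std_word (fill id P (reading_word T) (cf j (map (collapse_letter j m) (reading_word t)))) =
    reading_word (phi S').
  rewrite -W1 -W2; apply: std_wordE => //; rewrite W2 size_fill.
  rewrite (_ : size (reading_word T) = sumn lam).
    exact: perm_trans (perm_reading_word _) pLS'.
  by rewrite (perm_size (perm_trans (perm_reading_word T) pT)) size_iota.
apply/esym/of_wordE; rewrite size_of_word; last by rewrite rc !size_fill.
by rewrite ELS' -ELS /c /dyck_collapse -map_comp; apply: eq_map => r /=; rewrite size_map.
Qed.
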